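(* Let $k$ be a finite field of characteristic $p$ with $q$ elements, $G=\mathrm{GL}_3(k)$, and $U$ the subgroup of upper triangular unipotent matrices. Let $C$ be the representation of $G$ over $\overline{\mathbf F}_p$ induced from the trivial character of $U$, and $H=\mathrm{End}_G(C)$. Then the $H$-module $C$ is flat if and only if $q=p=2$.
   Context: $\overline{\mathbf F}_p$ is an algebraic closure of $k$. $C$ is the space of functions $G\to\overline{\mathbf F}_p$ invariant under left translations by $U$, with $G$ acting by right translations; it is a left $H$-module. *)

(* Defs.v *)
From HB Require Import structures.
From mathcomp Require Import all_boot all_order all_algebra all_fingroup.
From mathcomp Require Import freeg.
From mathcomp Require boolp.

Set Implicit Arguments.
Unset Strict Implicit.
Unset Printing Implicit Defensive.

Import GRing.Theory.
Local Open Scope ring_scope.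
Local Open Scope quotient_scope.

(* Right R-modules are left modules over the converse ring R^c: the right
   action m.r is (r : R^c) *: m. *)

Section Tensor.

Variables (R : pzRingType) (M : lmodType R^c) (N : lmodType R).

Definition free_tens (m : M) (n : N) : {freeg (M * N)%type} := << (m, n) >>.

Inductive tensor_rel : {freeg (M * N)%type} -> Prop :=
| TensorRel0 : tensor_rel 0
| TensorRelB u v : tensor_rel u -> tensor_rel v -> tensor_rel (u - v)
| TensorRelDl m m' n :
    tensor_rel (free_tens (m + m') n - (free_tens m n + free_tens m' n))
| TensorRelDr m n n' :
    tensor_rel (free_tens m (n + n') - (free_tens m n + free_tens m n'))
| TensorRelZ m (r : R) n :
    tensor_rel (free_tens ((r : R^c) *: m) n - free_tens m (r *: n)).

Definition tensor_relb : {pred {freeg (M * N)%type}} :=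
  fun u => boolp.asbool (tensor_rel u).

Lemma tensor_relP u : reflect (tensor_rel u) (u \in tensor_relb).
Proof. exact: boolp.asboolP. Qed.

Fact tensor_relb_zmod_closed : zmod_closed tensor_relb.
Proof.
split=> [|u v /tensor_relP hu /tensor_relP hv]; apply/tensor_relP.
  exact: TensorRel0.
exact: TensorRelB.
Qed.

HB.instance Definition _ :=
  GRing.isZmodClosed.Build {freeg (M * N)%type} tensor_relb
    tensor_relb_zmod_closed.

Definition tensor := Quotient.quot tensor_relb.
HB.instance Definition _ := GRing.Zmodule.on tensor.
HB.instance Definition _ := Quotient.on tensor.

Definition tens (m : M) (n : N) : tensor :=
  \pi_tensor (free_tens m n).

Lemma pi_tensor_eq (u v : {freeg (M * N)%type}) :
  (\pi_tensor u = \pi_tensor v) <-> tensor_rel (u - v).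
Proof.
split=> [/eqP|h].
  by rewrite -Quotient.idealrBE => /tensor_relP.
by apply/eqP; rewrite -Quotient.idealrBE; apply/tensor_relP.
Qed.

End Tensor.

Section TensorMap.

Variables (R : pzRingType) (M M' : lmodType R^c) (N : lmodType R).
Variable f : {linear M -> M'}.

Definition free_map (u : {freeg (M * N)%type}) : {freeg (M' * N)%type} :=
  fglift (fun z : M * N => free_tens (f z.1) z.2) u.

Definition tensor_map (t : tensor M N) : tensor M' N :=
  \pi_(tensor M' N) (free_map (generic_quotient.repr t)).

Fact free_map_zmod_morphism : zmod_morphism free_map.
Proof. exact: lift_is_additive. Qed.

HB.instance Definition _ :=
  GRing.isZmodMorphism.Build {freeg (M * N)%type} {freeg (M' * N)%type}
    free_map free_map_zmod_morphism.

Lemma free_mapU m n : free_map (free_tens m n) = free_tens (f m) n.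
Proof. by rewrite /free_map liftU scale1r /=. Qed.

Lemma free_map_rel u : tensor_rel u -> tensor_rel (free_map u).
Proof.
elim=> [|{}u v _ hu _ hv|m m' n|m n n'|m r n].
- by rewrite raddf0; apply: TensorRel0.
- by rewrite raddfB; apply: TensorRelB.
- by rewrite raddfB raddfD /= !free_mapU raddfD; apply: TensorRelDl.
- by rewrite raddfB raddfD /= !free_mapU; apply: TensorRelDr.
- by rewrite raddfB /= !free_mapU linearZ; apply: TensorRelZ.
Qed.

Lemma tensor_map_pi u :
  tensor_map (\pi_(tensor M N) u) = \pi_(tensor M' N) (free_map u).
Proof.
apply/pi_tensor_eq; rewrite -raddfB; apply: free_map_rel.
by apply/pi_tensor_eq; rewrite reprK.
Qed.

Lemma tensor_map_tens m n : tensor_map (tens m n) = tens (f m) n.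
Proof. by rewrite tensor_map_pi free_mapU. Qed.

Fact tensor_map_zmod_morphism : zmod_morphism tensor_map.
Proof.
move=> s t; rewrite -[s]reprK -[t]reprK -raddfB !tensor_map_pi.
by rewrite raddfB raddfB.
Qed.

HB.instance Definition _ :=
  GRing.isZmodMorphism.Build (tensor M N) (tensor M' N) tensor_map
    tensor_map_zmod_morphism.

End TensorMap.

Definition flat (R : pzRingType) (N : lmodType R) : Prop :=
  forall (M M' : lmodType R^c) (f : {linear M -> M'}),
    injective f -> injective (@tensor_map R M M' N f).

Section Induced.

Variables (F : fieldType) (gT : finGroupType).

Definition ltrans (u : gT) (f : {ffun gT -> F^o}) : {ffun gT -> F^o} :=
  [ffun x => f (u * x)%g].

Definition rtrans (g : gT) (f : {ffun gT -> F^o}) : {ffun gT -> F^o} :=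
  [ffun x => f (x * g)%g].

Fact ltrans_is_linear u : linear (ltrans u).
Proof. by move=> a f h; apply/ffunP=> x; rewrite !ffunE. Qed.

HB.instance Definition _ u :=
  GRing.isLinear.Build F {ffun gT -> F^o} {ffun gT -> F^o} _ (ltrans u)
    (ltrans_is_linear u).

Fact rtrans_is_linear g : linear (rtrans g).
Proof. by move=> a f h; apply/ffunP=> x; rewrite !ffunE. Qed.

HB.instance Definition _ g :=
  GRing.isLinear.Build F {ffun gT -> F^o} {ffun gT -> F^o} _ (rtrans g)
    (rtrans_is_linear g).

Variable U : {set gT}.

Definition ind1 : {vspace {ffun gT -> F^o}} :=
  (\bigcap_(u in U) fixedSpace (linfun (ltrans u)))%VS.

Lemma ind1P (f : {ffun gT -> F^o}) :
  reflect (forall u x : gT, u \in U -> f (u * x)%g = f x) (f \in ind1).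
Proof.
rewrite memvE /ind1; apply: (iffP subv_bigcapP) => [h u x uU|h u uU].
  have := h u uU; rewrite -memvE => /fixedSpaceP; rewrite lfunE /=.
  by move/ffunP/(_ x); rewrite ffunE.
rewrite -memvE; apply/fixedSpaceP; rewrite lfunE /=.
by apply/ffunP=> x; rewrite ffunE h.
Qed.

Lemma rtrans_ind1 g f : f \in ind1 -> rtrans g f \in ind1.
Proof.
by move/ind1P=> h; apply/ind1P=> u x uU; rewrite !ffunE -mulgA (h u).
Qed.

(* vsproj is used only on elements of ind1, where it inverts vsval: see
   ind1_actE. *)
Definition ind1_act (g : gT) : 'End(subvs_of ind1) :=
  linfun (vsproj ind1 \o rtrans g \o vsval).

Lemma ind1_actE g (c : subvs_of ind1) :
  vsval (ind1_act g c) = rtrans g (vsval c).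
Proof. by rewrite lfunE /= vsprojK // rtrans_ind1 // subvsP. Qed.

Definition G_equivariant : {pred 'End(subvs_of ind1)} :=
  fun phi => [forall g : gT, (phi \o ind1_act g == ind1_act g \o phi)%VF].

Lemma G_equivariantP (phi : 'End(subvs_of ind1)) :
  reflect (forall g c, phi (ind1_act g c) = ind1_act g (phi c))
          (phi \in G_equivariant).
Proof.
apply: (iffP forallP) => [h g c|h g].
  by rewrite -!comp_lfunE (eqP (h g)).
by apply/eqP/lfunP=> c; rewrite !comp_lfunE h.
Qed.

Fact G_equivariant_zmod_closed : zmod_closed G_equivariant.
Proof.
split=> [|phi psi /G_equivariantP hphi /G_equivariantP hpsi];
  apply/G_equivariantP=> g c.
  by rewrite !zero_lfunE linear0.
by rewrite !add_lfunE !opp_lfunE hphi hpsi linearB.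
Qed.

HB.instance Definition _ :=
  GRing.isZmodClosed.Build 'End(subvs_of ind1) G_equivariant
    G_equivariant_zmod_closed.

Record hecke : predArgType := Hecke {
  hecke_val : 'End(subvs_of ind1);
  hecke_valP : hecke_val \in G_equivariant }.

HB.instance Definition _ := [isSub for hecke_val].
HB.instance Definition _ := [Choice of hecke by <:].
HB.instance Definition _ := [SubChoice_isSubZmodule of hecke by <:].

Fact hecke1_subproof : (\1%VF : 'End(subvs_of ind1)) \in G_equivariant.
Proof. by apply/G_equivariantP=> g c; rewrite !id_lfunE. Qed.

Definition hecke1 : hecke := Hecke hecke1_subproof.

Fact hecke_mul_subproof (phi psi : hecke) :
  (hecke_val phi \o hecke_val psi)%VF \in G_equivariant.
Proof.
have /G_equivariantP hphi := hecke_valP phi.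
have /G_equivariantP hpsi := hecke_valP psi.
by apply/G_equivariantP=> g c; rewrite !comp_lfunE hpsi hphi.
Qed.

Definition hecke_mul (phi psi : hecke) : hecke :=
  Hecke (hecke_mul_subproof phi psi).

Fact hecke_mulA : associative hecke_mul.
Proof. by move=> a b c; apply/val_inj; apply: comp_lfunA. Qed.
Fact hecke_mul1r : left_id hecke1 hecke_mul.
Proof. by move=> a; apply/val_inj; apply: comp_lfun1l. Qed.
Fact hecke_mulr1 : right_id hecke1 hecke_mul.
Proof. by move=> a; apply/val_inj; apply: comp_lfun1r. Qed.
Fact hecke_mulDl : left_distributive hecke_mul +%R.
Proof. by move=> a b c; apply/val_inj; apply: comp_lfunDl. Qed.
Fact hecke_mulDr : right_distributive hecke_mul +%R.
Proof. by move=> a b c; apply/val_inj; apply: comp_lfunDr. Qed.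

HB.instance Definition _ := GRing.Zmodule_isPzRing.Build hecke
  hecke_mulA hecke_mul1r hecke_mulr1 hecke_mulDl hecke_mulDr.

(* An alias of subvs_of ind1, whose own canonical scalars are those of F. *)
Definition ind1_mod := subvs_of ind1.
HB.instance Definition _ := GRing.Zmodule.on ind1_mod.

Definition hecke_act (phi : hecke) (c : ind1_mod) : ind1_mod :=
  hecke_val phi c.

Fact hecke_actA phi psi c :
  hecke_act phi (hecke_act psi c) = hecke_act (phi * psi) c.
Proof. by rewrite /hecke_act /= comp_lfunE. Qed.
Fact hecke_act1 : left_id 1 hecke_act.
Proof. by move=> c; rewrite /hecke_act /= id_lfunE. Qed.
Fact hecke_actDr : right_distributive hecke_act +%R.
Proof. by move=> phi c d; rewrite /hecke_act raddfD. Qed.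
Fact hecke_actDl c : {morph hecke_act^~ c : phi psi / phi + psi}.
Proof. by move=> phi psi; rewrite /hecke_act /= add_lfunE. Qed.

HB.instance Definition _ := GRing.Zmodule_isLmodule.Build hecke ind1_mod
  hecke_actA hecke_act1 hecke_actDr hecke_actDl.

End Induced.

Definition unitri (k : finFieldType) : {set {'GL_3[k]}} :=
  [set g : {'GL_3[k]} | [forall i, forall j,
     ((i == j) ==> (GLval g i j == 1)) && ((j < i)%N ==> (GLval g i j == 0))]].

(* Main.v *)
Require Import Defs.
From HB Require Import structures.
From mathcomp Require Import all_boot all_order all_algebra all_fingroup all_field.
From mathcomp Require Import freeg ring.
From mathcomp Require boolp.

Set Implicit Arguments.
Unset Strict Implicit.
Unset Printing Implicit Defensive.

Import GRing.Theory.
Local Open Scope ring_scope.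
Local Open Scope quotient_scope.

(** The theorem separates two quite different situations.

Identify an element of C with a function f on G that is left invariant under U.
For x in G let v be its last row and phi the vector product of its last two
rows, so that phi(v) = 0: up to scalars (v, phi) is the flag attached to x.
The endomorphisms of C that are used are linear combinations of left
translations ([hecke_ltcomb]), among them those of the torus T and, for the two
simple reflections, the sums T_1 and T_2 over a double coset U s_i U modulo U.

Suppose that q > 2.  In a flat module every relation sum h_i c = 0 follows from
relations in the ring ([flat_relation]).  Impose on c the weight given by the
middle entry of T together with T_1 c = T_2 c = 0.  A polynomial of degree q - 2
in v and 1 in phi satisfies this, because the sum over k of a polynomial of
degree less than q - 1 is zero.  On the other hand, if h in H satisfies the same
relations then h maps the indicator function of U to a multiple of
v_0 ^ (q - 2) phi_2 ([annihilated_fun]), and as C is generated by that indicator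
function, the values of h are combinations of the translates
l(v) ^ (q - 2) lambda(phi), where l and lambda are incident.  Now assign to
sum_j F_j(v) phi_j its divergence sum_j dF_j / dv_j.  It is well defined: the
multiple G(v) phi(v) of the equation of the flags, with G of degree q - 3, has
divergence (3 + (q - 3)) G = 0.  The divergence of l(v) ^ (q - 2) lambda(phi) is
proportional to lambda(l) = 0, while v_0 ^ (q - 3) v_1 phi_1 has the nonzero
divergence v_0 ^ (q - 3).  Thus C is not flat ([not_flat_of_card_gt2]).

Suppose that q = 2.  Then T is trivial and H is generated by the idempotents
T_1 and T_2, subject to the braid relation: it is spanned by the six products
T_w, w in S_3 ([hecke_span]).  With Tbar_i = 1 + T_i and w0 the longest element,
the families T_w and Tbar_(w^-1 w0) are dual bases for the form that takes the
coefficient of T_w0, so that for every linear form eta on C the map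
c |-> sum_w eta(T_w c) Tbar_(w^-1 w0) from C to H is H-linear
([lambda_linear]).  Hence C is projective as soon as the identity of C is
sum_w Tbar_(w^-1 w0) Theta T_w for some linear map Theta (Higman's criterion).
There is a subgroup K of order 21, generated by elements tau and sigma of
order 3, which acts simply transitively on the 21 flags, so that G = U K and C
is the space of functions on K; moreover T_1 = tau + tau^2 and
T_2 = sigma + sigma^2.  The equation for Theta can then be solved inside the
group algebra of K, and Theta = 1 + g + g^-1 with g = tau sigma is a solution.
Checking it is a finite computation with 3 x 3 matrices over the field with two
elements ([higman_check]); the dual basis that results shows that C is flat
([dual_basis_flat]). *)

(** * Tensor products *)

Section TensorLift.

Variables (R : pzRingType) (M : lmodType R^c) (N : lmodType R) (A : zmodType).
Variable beta : M -> N -> A.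
Hypothesis betaDl : forall m m' n, beta (m + m') n = beta m n + beta m' n.
Hypothesis betaDr : forall m n n', beta m (n + n') = beta m n + beta m n'.
Hypothesis betaZ :
  forall m (r : R) n, beta ((r : R^c) *: m) n = beta m (r *: n).

Definition free_lift : {freeg (M * N)%type} -> A :=
  fglift (fun z : M * N => beta z.1 z.2 : zmodule A).

Fact free_lift_zmod_morphism : zmod_morphism free_lift.
Proof. exact: (@lift_is_additive _ _ (zmodule A)). Qed.
HB.instance Definition _ :=
  GRing.isZmodMorphism.Build {freeg (M * N)%type} A free_lift
    free_lift_zmod_morphism.

Lemma free_liftU m n : free_lift (free_tens m n) = beta m n.
Proof. by rewrite /free_lift liftU /= scalezrE mulr1z. Qed.

Lemma free_lift_rel u : tensor_rel u -> free_lift u = 0.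
Proof.
elim=> [|{}u v _ hu _ hv|m m' n|m n n'|m r n].
- by rewrite raddf0.
- by rewrite raddfB /= hu hv subr0.
- by rewrite raddfB raddfD /= !free_liftU betaDl subrr.
- by rewrite raddfB raddfD /= !free_liftU betaDr subrr.
- by rewrite raddfB /= !free_liftU betaZ subrr.
Qed.

Definition tensor_lift (t : tensor M N) : A :=
  free_lift (generic_quotient.repr t).

Lemma tensor_lift_pi u : tensor_lift (\pi_(tensor M N) u) = free_lift u.
Proof.
apply/eqP; rewrite -subr_eq0 /tensor_lift -raddfB; apply/eqP.
by apply: free_lift_rel; apply/pi_tensor_eq; rewrite reprK.
Qed.

Lemma tensor_lift_tens m n : tensor_lift (tens m n) = beta m n.
Proof. by rewrite tensor_lift_pi free_liftU. Qed.

Fact tensor_lift_zmod_morphism : zmod_morphism tensor_lift.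
Proof.
move=> s t; rewrite -[s]reprK -[t]reprK -raddfB !tensor_lift_pi.
by rewrite raddfB.
Qed.
HB.instance Definition _ :=
  GRing.isZmodMorphism.Build (tensor M N) A tensor_lift
    tensor_lift_zmod_morphism.

End TensorLift.

Section TensorFacts.

Variables (R : pzRingType) (M : lmodType R^c) (N : lmodType R).

Lemma tensDl (m m' : M) (n : N) : tens (m + m') n = tens m n + tens m' n.
Proof.
by rewrite /tens -raddfD; apply/pi_tensor_eq; apply: TensorRelDl.
Qed.

Lemma tensDr (m : M) (n n' : N) : tens m (n + n') = tens m n + tens m n'.
Proof.
by rewrite /tens -raddfD; apply/pi_tensor_eq; apply: TensorRelDr.
Qed.

Lemma tensZ (m : M) (r : R) (n : N) :
  tens ((r : R^c) *: m) n = tens m (r *: n).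
Proof. by apply/pi_tensor_eq; apply: TensorRelZ. Qed.

Lemma tens_0 (m : M) : tens m (0 : N) = 0.
Proof. by apply: (addrI (tens m 0)); rewrite -tensDr !addr0. Qed.

Lemma tens0_ (n : N) : tens (0 : M) n = 0.
Proof. by apply: (addrI (tens 0 n)); rewrite -tensDl !addr0. Qed.

Lemma tens_sumr (I : finType) (m : M) (n : I -> N) :
  tens m (\sum_i n i) = \sum_i tens m (n i).
Proof.
exact: (big_morph (tens m) (tensDr m) (tens_0 m)).
Qed.

Lemma tens_suml (I : finType) (m : I -> M) (n : N) :
  tens (\sum_i m i) n = \sum_i tens (m i) n.
Proof.
by apply: (big_morph (fun x => tens x n)) => [x y|]; rewrite ?tensDl ?tens0_.
Qed.

(** The pure tensors generate, being the images of the generators of the free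
    group. *)
Lemma tensor_ext (A : zmodType) (f g : {additive tensor M N -> A}) :
  (forall m n, f (tens m n) = g (tens m n)) -> f =1 g.
Proof.
move=> fg t; rewrite -[t]reprK -[generic_quotient.repr t]freeg_sumE.
rewrite !raddf_sum /=; apply: eq_bigr => -[m n] _.
set c := coeff _ _; have -> : << c *g (m, n) >> = free_tens m n *~ c.
  by rewrite /free_tens freeg_mulz; congr << _ *g _ >>; rewrite intz.
by rewrite !raddfMz /= fg.
Qed.

End TensorFacts.

(** * Flatness: dual bases and relations *)

Section DualBasis.

Variables (R : pzRingType) (N : lmodType R) (J : finType).
Variables (c : J -> N) (lam : J -> N -> R).
Hypothesis lamD : forall j x y, lam j (x + y) = lam j x + lam j y.
Hypothesis lamZ : forall j r x, lam j (r *: x) = r * lam j x.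
Hypothesis lamK : forall x, \sum_j lam j x *: c j = x.

Section Contract.
Variables (M : lmodType R^c) (j : J).

(** Each functional of the dual basis contracts M (x) N to M; these contractions
    are natural in M, which is what makes them transport injectivity. *)
Definition contract_fun (m : M) (n : N) : M := (lam j n : R^c) *: m.

Fact contractDl m m' n :
  contract_fun (m + m') n = contract_fun m n + contract_fun m' n.
Proof. exact: scalerDr. Qed.
Fact contractDr m n n' :
  contract_fun m (n + n') = contract_fun m n + contract_fun m n'.
Proof. by rewrite /contract_fun lamD; exact: scalerDl. Qed.
Fact contractZ m (r : R) n :
  contract_fun ((r : R^c) *: m) n = contract_fun m (r *: n).
Proof. by rewrite /contract_fun lamZ scalerA. Qed.

Definition contract : tensor M N -> M := tensor_lift contract_fun.
HB.instance Definition _ := GRing.isZmodMorphism.Build (tensor M N) M contract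
  (tensor_lift_zmod_morphism contractDl contractDr contractZ).

Lemma contract_tens m n : contract (tens m n) = (lam j n : R^c) *: m.
Proof. exact: (tensor_lift_tens contractDl contractDr contractZ). Qed.

End Contract.

(** Tensoring the identity [lamK] with M: an element of M (x) N is determined by
    its contractions. *)
Lemma contractK (M : lmodType R^c) (t : tensor M N) :
  t = \sum_j tens (contract j t) (c j).
Proof.
pose g (t : tensor M N) := \sum_j tens (contract j t) (c j).
have gD : zmod_morphism g.
  move=> s u; rewrite /g -sumrB; apply: eq_bigr => j _.
  rewrite raddfB /=; apply: (addIr (tens (contract j u) (c j))).
  by rewrite -tensDl !subrK.
pose gA := GRing.isZmodMorphism.Build (tensor M N) (tensor M N) g gD.
pose G : {additive tensor M N -> tensor M N} := HB.pack g gA.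
apply: (tensor_ext (f := idfun) (g := G)) => m n /=.
rewrite /g -{1}(lamK n) tens_sumr; apply: eq_bigr => j _.
by rewrite contract_tens tensZ.
Qed.

(** If f (x) N kills t then f kills every contraction of t, hence they vanish,
    hence so does t. *)
Lemma dual_basis_flat : flat N.
Proof.
move=> M M' f f_inj; apply: raddf_inj => t t0.
rewrite (contractK t) big1 // => j _.
suff -> : contract j t = 0 by rewrite tens0_.
apply: f_inj; rewrite raddf0.
have e : (f \o contract (M := M) j) =1
         (contract (M := M') j \o tensor_map (N := N) f).
  apply: tensor_ext => m n /=.
  by rewrite tensor_map_tens !contract_tens linearZ.
by have /= -> := e t; rewrite t0 raddf0.
Qed.

End DualBasis.

Section Equational.

Variables (R : pzRingType) (I : finType) (h : I -> R).

Let RI := {ffun I -> R^c^o}.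

(** The right submodule of R^I generated by the family h. *)
Definition in_rspan : {pred RI} :=
  fun m => boolp.asbool (exists x : R, m = [ffun i => (h i * x : R^c^o)]).

Fact in_rspan_submod : submod_closed in_rspan.
Proof.
split=> [|a u v /boolp.asboolP[x ->] /boolp.asboolP[y ->]];
  apply/boolp.asboolP.
  by exists 0; apply/ffunP=> i; rewrite !ffunE mulr0.
by exists (x * a + y); apply/ffunP=> i; rewrite !ffunE mulrDr mulrA.
Qed.

HB.instance Definition _ := GRing.isSubmodClosed.Build R^c RI in_rspan
  in_rspan_submod.

Record rspan := RSpan { rspan_val :> RI; rspan_valP : rspan_val \in in_rspan }.
HB.instance Definition _ := [isSub for rspan_val].
HB.instance Definition _ := [Choice of rspan by <:].
HB.instance Definition _ := [SubChoice_isSubLmodule of rspan by <:].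

Lemma rspanP (m : rspan) : exists x : R, val m = [ffun i => (h i * x : R^c^o)].
Proof. by case: m => m /= /boolp.asboolP. Qed.

Definition rspan_coef (m : rspan) : R := projT1 (boolp.cid (rspanP m)).

Lemma rspan_coefE (m : rspan) i : val m i = h i * rspan_coef m.
Proof.
by rewrite /rspan_coef; case: boolp.cid => x /= ->; rewrite ffunE.
Qed.

(** Inside R^I (x) N the element h (x) c vanishes since its components are h_i c.
    By flatness it already vanishes in (h R) (x) N.  The form L descends to the
    latter through h x (x) n |-> L (x n), which is well defined exactly because L
    kills the products of the annihilator of h with N. *)
Lemma flat_relation (N : lmodType R) (A : zmodType) (L : {additive N -> A})
    (c : N) :
  flat N -> (forall i, h i *: c = 0) ->
  (forall x, (forall i, h i * x = 0) -> forall n, L (x *: n) = 0) ->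
  L c = 0.
Proof.
move=> flatN hc Lann.
have Lcoef (m : rspan) y n : (forall i, val m i = h i * y) ->
    L (rspan_coef m *: n) = L (y *: n).
  move=> my; apply/eqP; rewrite -subr_eq0 -raddfB -scalerBl; apply/eqP.
  by apply: Lann => i; rewrite mulrBr -my rspan_coefE subrr.
pose beta (m : rspan) n := L (rspan_coef m *: n).
have bDl m m' n : beta (m + m') n = beta m n + beta m' n.
  rewrite /beta -raddfD -scalerDl; apply: Lcoef => i.
  by rewrite raddfD /= ffunE !rspan_coefE mulrDr.
have bDr m n n' : beta m (n + n') = beta m n + beta m n'.
  by rewrite /beta scalerDr raddfD.
have bZ m (r : R) n : beta ((r : R^c) *: m) n = beta m (r *: n).
  rewrite /beta scalerA; apply: Lcoef => i.
  by rewrite linearZ /= ffunE !rspan_coefE mulrA.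
have h1P : [ffun i => (h i : R^c^o)] \in in_rspan.
  by apply/boolp.asboolP; exists 1; apply/ffunP=> i; rewrite !ffunE mulr1.
pose h1 : rspan := RSpan h1P.
have h1c : tens h1 c = 0.
  apply: (flatN _ _ (val : {linear rspan -> RI}) val_inj).
  rewrite raddf0 tensor_map_tens /=.
  have -> : [ffun i => (h i : R^c^o)] =
      \sum_i ((h i : R^c) *: [ffun j => (if j == i then 1 : R else 0) : R^c^o]).
    apply/ffunP=> j; rewrite sum_ffunE ffunE (bigD1 j) //= big1 => [|i ij].
      by rewrite !ffunE eqxx addr0; exact: (esym (@mulr1 R^c (h j))).
    by rewrite !ffunE eq_sym (negbTE ij); exact: (@mulr0 R^c (h i)).
  by rewrite tens_suml big1 // => i _; rewrite tensZ hc tens_0.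
have := tensor_lift_tens bDl bDr bZ h1 c; rewrite h1c.
have -> : tensor_lift beta (0 : tensor rspan N) = 0.
  pose tl := GRing.isZmodMorphism.Build _ _ _
    (tensor_lift_zmod_morphism bDl bDr bZ).
  exact: (raddf0 (HB.pack (tensor_lift beta) tl : {additive _ -> _})).
by rewrite /beta (Lcoef _ 1) ?scale1r // => i; rewrite /= ffunE mulr1.
Qed.

End Equational.

(** * The Hecke algebra of an induced representation *)

Section InducedFacts.

Variables (F : fieldType) (gT : finGroupType) (U : {group gT}).

Local Notation V := {ffun gT -> F^o}.
Local Notation C := (ind1_mod F U).
Local Notation H := (hecke F U).

Definition ind1_fun (c : C) : V := vsval (c : subvs_of (ind1 F U)).

Lemma ind1_fun_inj : injective ind1_fun.
Proof. exact: val_inj. Qed.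

Fact ind1_fun_zmod_morphism : zmod_morphism ind1_fun.
Proof. by move=> c d; rewrite /ind1_fun linearB. Qed.
HB.instance Definition _ := GRing.isZmodMorphism.Build C V ind1_fun ind1_fun_zmod_morphism.

Lemma ind1_funUl (c : C) u x : u \in U -> ind1_fun c (u * x)%g = ind1_fun c x.
Proof. by move=> uU; have /ind1P/(_ u x uU) := subvsP c. Qed.

Definition ind1_elt (f : V) (hf : f \in ind1 F U) : C := Subvs hf.

(** A list of weighted group elements stands for an operator on functions.  Left
    translations commute with the action of G, so such an operator lies in the
    Hecke algebra as soon as it preserves left invariance under U. *)
Definition ltcomb (s : seq (F * gT)) (f : V) : V :=
  [ffun x => \sum_(p <- s) p.1 * (f (p.2 * x)%g : F)].

Fact ltcomb_is_linear s : linear (ltcomb s).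
Proof.
move=> a f h; apply/ffunP=> x; rewrite !ffunE scaler_sumr -big_split /=.
apply: eq_bigr => p _; rewrite !ffunE mulrDr; congr (_ + _).
exact: mulrCA.
Qed.
HB.instance Definition _ s :=
  GRing.isLinear.Build F V V _ (ltcomb s) (ltcomb_is_linear s).

Lemma ltcomb_rtrans s g f : ltcomb s (rtrans g f) = rtrans g (ltcomb s f).
Proof.
by apply/ffunP=> x; rewrite !ffunE; apply: eq_bigr => p _; rewrite ffunE mulgA.
Qed.

Definition stable s := forall f, f \in ind1 F U -> ltcomb s f \in ind1 F U.

Section Hecke.
Variables (s : seq (F * gT)) (hs : stable s).

Definition ltcomb_end : 'End(subvs_of (ind1 F U)) :=
  linfun (vsproj (ind1 F U) \o ltcomb s \o vsval).

Lemma ltcomb_endE c : vsval (ltcomb_end c) = ltcomb s (vsval c).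
Proof. by rewrite lfunE /= vsprojK // hs // subvsP. Qed.

Fact hecke_ltcomb_subproof : ltcomb_end \in @G_equivariant F gT U.
Proof.
apply/G_equivariantP=> g c; apply: val_inj.
have := ltcomb_endE (ind1_act F U g c); rewrite ind1_actE ltcomb_rtrans -ltcomb_endE.
by rewrite -ind1_actE.
Qed.

Definition hecke_ltcomb : H := Hecke hecke_ltcomb_subproof.

Lemma hecke_ltcombE (c : C) : ind1_fun (hecke_ltcomb *: c) = ltcomb s (ind1_fun c).
Proof. exact: ltcomb_endE. Qed.

End Hecke.

Definition delta_fun : V := [ffun x => (x \in U)%:R].

Fact delta_fun_ind1 : delta_fun \in ind1 F U.
Proof. by apply/ind1P => u x uU; rewrite !ffunE groupMl. Qed.

Definition delta : C := ind1_elt delta_fun_ind1.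

Lemma ind1_fun_delta x : ind1_fun delta x = (x \in U)%:R.
Proof. by rewrite ffunE. Qed.

Lemma hecke_rtrans (h : H) (c d : C) g :
  ind1_fun d = rtrans g (ind1_fun c) -> ind1_fun (h *: d) = rtrans g (ind1_fun (h *: c)).
Proof.
move=> dc; have -> : d = ind1_act F U g c.
  by apply: ind1_fun_inj; rewrite dc /ind1_fun ind1_actE.
have /G_equivariantP/(_ g c) := hecke_valP h.
by move=> e; rewrite -ind1_actE; congr (vsval _).
Qed.

Lemma ind1_fun_sum (I : Type) (r : seq I) (P : pred I) (c : I -> C) :
  ind1_fun (\sum_(i <- r | P i) c i) = \sum_(i <- r | P i) ind1_fun (c i).
Proof. exact: raddf_sum. Qed.

(** The base field acts on C by scalars, although C is only considered as a module
    over the Hecke algebra; elements of the latter are linear over the field. *)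
Lemma hecke_scalar (h : H) (a : F) (c d : C) :
  ind1_fun d = a *: ind1_fun c -> ind1_fun (h *: d) = a *: ind1_fun (h *: c).
Proof.
move=> dc; have -> : d = (a *: (c : subvs_of (ind1 F U)) : subvs_of _).
  by apply: ind1_fun_inj; rewrite dc /ind1_fun linearZ.
by rewrite /ind1_fun /GRing.scale /= /hecke_act linearZ.
Qed.

(** The translates of the indicator function of U span C, so that an element of
    the Hecke algebra is determined by its value there. *)
Lemma hecke_delta (h : H) (c : C) :
  ind1_fun (h *: c) = \sum_(X in rcosets U [set: gT])
     (ind1_fun c (repr X) : F) *: rtrans (repr X)^-1 (ind1_fun (h *: delta)).
Proof.
have tP (X : {set gT}) :
    (ind1_fun c (repr X) : F) *: rtrans (repr X)^-1 (ind1_fun delta) \in ind1 F U.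
  by rewrite rpredZ // rtrans_ind1 // subvsP.
have rP (X : {set gT}) : rtrans (repr X)^-1 (ind1_fun delta) \in ind1 F U.
  by rewrite rtrans_ind1 // subvsP.
have ec : c = \sum_(X in rcosets U [set: gT]) ind1_elt (tP X).
  apply: ind1_fun_inj; rewrite ind1_fun_sum; apply/ffunP=> x; rewrite sum_ffunE.
  have Ux : (U :* x)%g \in rcosets U [set: gT].
    by apply/rcosetsP; exists x; rewrite ?inE.
  rewrite (bigD1 (U :* x)%g) //= big1 => [|X /andP[/rcosetsP[y _ ->] neq]].
    rewrite addr0 !ffunE; case: repr_rcosetP => u uU.
    by rewrite ind1_funUl // invMg mulgA mulgV mul1g groupV uU; exact/esym/mulr1.
  rewrite !ffunE; case: repr_rcosetP => u uU.
  case: (boolP (_ \in U)) => [xy|_]; last exact: mulr0.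
  case/eqP: neq; apply/esym/rcoset_eqP; rewrite mem_rcoset.
  by move: xy; rewrite invMg mulgA groupMr ?groupV.
rewrite {1}ec scaler_sumr ind1_fun_sum; apply: eq_bigr => X _.
have e : ind1_fun (ind1_elt (tP X)) = (ind1_fun c (repr X) : F) *: ind1_fun (ind1_elt (rP X)) by [].
by rewrite (hecke_scalar h e); congr (_ *: _); apply: hecke_rtrans.
Qed.

Lemma hecke_eq (h h' : H) : h *: delta = h' *: delta -> h = h'.
Proof.
move=> e; apply: val_inj; apply/lfunP => c; apply: ind1_fun_inj.
have := hecke_delta h c; rewrite e -(hecke_delta h' c); exact.
Qed.

(** The indicator function of U is fixed by right translations by U, hence so are
    its images: the Hecke algebra embeds in the bi-invariant functions. *)
Lemma hecke_delta_rinv (h : H) x u : u \in U ->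
  ind1_fun (h *: delta) (x * u)%g = ind1_fun (h *: delta) x.
Proof.
move=> uU; have e : ind1_fun delta = rtrans u (ind1_fun delta).
  by apply/ffunP=> y; rewrite !ffunE groupMr.
by rewrite {2}(hecke_rtrans h e) ffunE.
Qed.

End InducedFacts.

(** * 3 x 3 matrices and the Bruhat decomposition *)

Local Notation i0 := (ord0 : 'I_3).
Local Notation i1 := (Ordinal (isT : 1 < 3)%N).
Local Notation i2 := (Ordinal (isT : 2 < 3)%N).

Lemma ord3P (P : 'I_3 -> Prop) : P i0 -> P i1 -> P i2 -> forall i, P i.
Proof.
move=> p0 p1 p2 [[|[|[|i]]] hi] //; first by rewrite (_ : Ordinal hi = i0) //; apply: val_inj.
  by rewrite (_ : Ordinal hi = i1) //; apply: val_inj.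
by rewrite (_ : Ordinal hi = i2) //; apply: val_inj.
Qed.

Section Mx3.

Variable R : comPzRingType.

Definition mx3 (a b c d e f g h i : R) : 'M[R]_3 :=
  \matrix_(r, s) nth 0 (nth [::] [:: [:: a; b; c]; [:: d; e; f]; [:: g; h; i]] r) s.

Lemma mx3_eta (A : 'M[R]_3) :
  A = mx3 (A i0 i0) (A i0 i1) (A i0 i2) (A i1 i0) (A i1 i1) (A i1 i2)
          (A i2 i0) (A i2 i1) (A i2 i2).
Proof.
by apply/matrixP; apply: ord3P; apply: ord3P; rewrite mxE.
Qed.

Lemma mx3M a b c d e f g h i a' b' c' d' e' f' g' h' i' :
  mx3 a b c d e f g h i *m mx3 a' b' c' d' e' f' g' h' i' =
  mx3 (a * a' + b * d' + c * g') (a * b' + b * e' + c * h')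
      (a * c' + b * f' + c * i')
      (d * a' + e * d' + f * g') (d * b' + e * e' + f * h')
      (d * c' + e * f' + f * i')
      (g * a' + h * d' + i * g') (g * b' + h * e' + i * h')
      (g * c' + h * f' + i * i').
Proof.
apply/matrixP; apply: ord3P; apply: ord3P;
  by rewrite !mxE !big_ord_recr big_ord0 /= !mxE /= add0r.
Qed.

Lemma mx3_1 : mx3 1 0 0 0 1 0 0 0 1 = 1%:M.
Proof. by apply/matrixP; apply: ord3P; apply: ord3P; rewrite !mxE. Qed.

Lemma det_mx3 a b c d e f g h i :
  \det (mx3 a b c d e f g h i) =
  a * (e * i - f * h) - b * (d * i - f * g) + c * (d * h - e * g).
Proof.
rewrite (expand_det_row _ i0) !big_ord_recr big_ord0 /cofactor /=.
rewrite !(expand_det_row _ ord0) !big_ord_recr !big_ord0 /cofactor /=.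
rewrite !det_mx11 !mxE /=; ring.
Qed.

Lemma mx3_inj a b c d e f g h i a' b' c' d' e' f' g' h' i' :
  mx3 a b c d e f g h i = mx3 a' b' c' d' e' f' g' h' i' ->
  [/\ [/\ a = a', b = b' & c = c'], [/\ d = d', e = e' & f = f']
    & [/\ g = g', h = h' & i = i']].
Proof.
move/matrixP => E; move: (E i0 i0) (E i0 i1) (E i0 i2) (E i1 i0) (E i1 i1)
  (E i1 i2) (E i2 i0) (E i2 i1) (E i2 i2).
by rewrite !mxE.
Qed.

End Mx3.

Section Bruhat.

Variable K : fieldType.
Implicit Types a b c d e f g h i p q r x y z : K.

Definition unimx a b c : 'M[K]_3 := mx3 1 a b 0 1 c 0 0 1.

(** The constructor Mono followed by i j k has its entries in columns i, j, k of
    rows 0, 1, 2. *)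
Inductive monomial : 'M[K]_3 -> Prop :=
| Mono012 p q r : monomial (mx3 p 0 0 0 q 0 0 0 r)
| Mono021 p q r : monomial (mx3 p 0 0 0 0 q 0 r 0)
| Mono102 p q r : monomial (mx3 0 p 0 q 0 0 0 0 r)
| Mono120 p q r : monomial (mx3 0 p 0 0 0 q r 0 0)
| Mono201 p q r : monomial (mx3 0 0 p q 0 0 0 r 0)
| Mono210 p q r : monomial (mx3 0 0 p 0 q 0 r 0 0).

Lemma monomial_by M N : monomial N -> M = N -> monomial M.
Proof. by move=> mN ->. Qed.

(** Gaussian elimination: the first nonzero entry of the last row clears the rest
    of its row to the right and of its column above, and the same is repeated in
    the remaining 2 x 2 block. *)
Lemma bruhat_mx (A : 'M[K]_3) : \det A != 0 ->
  exists x y z x' y' z', monomial (unimx x y z *m A *m unimx x' y' z').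
Proof.
rewrite (mx3_eta A) det_mx3.
move: (A i0 i0) (A i0 i1) (A i0 i2) (A i1 i0) (A i1 i1) (A i1 i2)
  (A i2 i0) (A i2 i1) (A i2 i2) => a b c d e f g h i detA.
case: (eqVneq g 0) => [g0|g0]; last first.
  case: (eqVneq (e * g) (d * h)) => [e0|e0].
    have e1 : e = d * h / g by apply: (canRL (mulfK g0)).
    have f1 : f * g - d * i != 0.
      apply: contraNneq detA => f0; have f2 : f = d * i / g.
        by apply: (canRL (mulfK g0)); apply/eqP; rewrite -subr_eq0 f0.
      by rewrite e1 f2; apply/eqP; field.
    exists (- (c * g - a * i) / (f * g - d * i)),
      (- (a - (c * g - a * i) / (f * g - d * i) * d) / g), (- d / g),
      (- h / g), (- i / g), 0.
    rewrite /unimx !mx3M e1; apply: monomial_by (Mono120 _ _ _) _.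
    by congr mx3; field; do ?[apply/andP; split].
  have e1 : e * g - d * h != 0 by rewrite subr_eq0.
  exists (- (b * g - a * h) / (e * g - d * h)),
    (- (a - (b * g - a * h) / (e * g - d * h) * d) / g), (- d / g),
    (- h / g), ((h * (f * g - d * i) / (e * g - d * h) - i) / g),
    (- (f * g - d * i) / (e * g - d * h)).
  rewrite /unimx !mx3M; apply: monomial_by (Mono210 _ _ _) _.
  by congr mx3; field; do ?[apply/andP; split].
subst g; case: (eqVneq h 0) => [h0|h0]; last first.
  case: (eqVneq d 0) => [d0|d0].
    subst d; have f1 : f * h - e * i != 0.
      apply: contraNneq detA => f0; have f2 : f = e * i / h.
        by apply: (canRL (mulfK h0)); apply/eqP; rewrite -subr_eq0 f0.
      by rewrite f2; apply/eqP; field.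
    exists (- (c * h - b * i) / (f * h - e * i)),
      (- (b - (c * h - b * i) / (f * h - e * i) * e) / h), (- e / h),
      0, 0, (- i / h).
    rewrite /unimx !mx3M; apply: monomial_by (Mono021 _ _ _) _.
    by congr mx3; field; do ?[apply/andP; split].
  exists (- a / d), (- (b - a / d * e) / h), (- e / h), 0,
    (- (f - e * i / h) / d), (- i / h).
  rewrite /unimx !mx3M; apply: monomial_by (Mono201 _ _ _) _.
  by congr mx3; field; do ?[apply/andP; split].
subst h; case: (eqVneq i 0) => [i0'|i0'].
  by subst i; case/eqP: detA; ring.
case: (eqVneq d 0) => [d0|d0].
  subst d; have e0 : e != 0 by apply: contraNneq detA => ->; apply/eqP; ring.
  exists (- b / e), (- (c - b / e * f) / i), (- f / i), 0, 0, 0.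
  rewrite /unimx !mx3M; apply: monomial_by (Mono012 _ _ _) _.
  by congr mx3; field; do ?[apply/andP; split].
exists (- a / d), (- (c - a / d * f) / i), (- f / i), (- e / d), 0, 0.
rewrite /unimx !mx3M; apply: monomial_by (Mono102 _ _ _) _.
by congr mx3; field; do ?[apply/andP; split].
Qed.

End Bruhat.

Section GL3.

Variable k : finFieldType.
Local Notation G := {'GL_3[k]}.
Implicit Types (a b c p q r : k) (g x y : G).

Definition gl3 (A : 'M[k]_3) : G := insubd (1%g : G) A.

Lemma gl3E (A : 'M[k]_3) : A \in unitmx -> GLval (gl3 A) = A.
Proof. by move=> uA; apply: (insubdK (1%g : G)). Qed.

Lemma GLvalM g x : GLval (g * x)%g = GLval g *m GLval x.
Proof. by case: g; case: x. Qed.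

Lemma GLval1 : GLval (1%g : G) = 1%:M.
Proof. by []. Qed.

Lemma GLval_inj : injective (GLval : G -> 'M[k]_3).
Proof. exact: val_inj. Qed.

Lemma GLval_unitmx g : GLval g \in unitmx.
Proof. exact: (valP g). Qed.

Lemma det_GL g : \det (GLval g) != 0.
Proof. by have := GLval_unitmx g; rewrite unitmxE unitfE. Qed.

Lemma unitmx_det (A : 'M[k]_3) : \det A != 0 -> A \in unitmx.
Proof. by rewrite unitmxE unitfE. Qed.

Lemma gl3M (A B : 'M[k]_3) : A \in unitmx -> B \in unitmx ->
  (gl3 A * gl3 B)%g = gl3 (A *m B).
Proof.
by move=> uA uB; apply: GLval_inj; rewrite GLvalM !gl3E // unitmx_mul uA.
Qed.

Lemma unimx_unit a b c : unimx a b c \in unitmx.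
Proof.
by apply: unitmx_det; rewrite det_mx3 !(mul0r, mulr0, subr0, mul1r, addr0) oner_eq0.
Qed.

Definition uni a b c : G := gl3 (unimx a b c).

Lemma uniE a b c : GLval (uni a b c) = unimx a b c.
Proof. exact/gl3E/unimx_unit. Qed.

Lemma unitriP g :
  reflect (exists a b c, g = uni a b c) (g \in unitri k).
Proof.
rewrite inE; apply: (iffP idP) => [/forallP h|[a [b [c ->]]]].
  have d (i : 'I_3) : GLval g i i = 1.
    by have /forallP/(_ i)/andP[] := h i; rewrite eqxx => /eqP.
  have l (i j : 'I_3) : (j < i)%N -> GLval g i j = 0.
    by move=> ij; have /forallP/(_ j)/andP[_] := h i; rewrite ij => /eqP.
  exists (GLval g i0 i1), (GLval g i0 i2), (GLval g i1 i2).
  by apply: GLval_inj; rewrite uniE {1}[GLval g]mx3_eta !d (l i1 i0) ?(l i2 i0) ?(l i2 i1).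
rewrite uniE /unimx; apply/forallP; apply: ord3P; apply/forallP; apply: ord3P;
  by rewrite !mxE /= ?eqxx.
Qed.

Lemma uni_in a b c : uni a b c \in unitri k.
Proof. by apply/unitriP; exists a, b, c. Qed.

Lemma uniM a b c a' b' c' :
  (uni a b c * uni a' b' c')%g = uni (a + a') (b + a * c' + b') (c + c').
Proof.
by apply: GLval_inj; rewrite GLvalM !uniE mx3M; congr mx3; ring.
Qed.

Lemma uni0 : uni 0 0 0 = 1%g.
Proof. by apply: GLval_inj; rewrite uniE GLval1 -mx3_1. Qed.

Fact unitri_group_set : group_set (unitri k).
Proof.
apply/group_setP; split=> [|_ _ /unitriP[a [b [c ->]]] /unitriP[a' [b' [c' ->]]]].
  by rewrite -uni0 uni_in.
by rewrite uniM uni_in.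
Qed.
Canonical unitri_group := Group unitri_group_set.

Lemma bruhat g :
  exists2 u, u \in unitri k & exists2 u', u' \in unitri k &
    monomial (GLval (u * g * u')%g).
Proof.
have [x [y [z [x' [y' [z' m]]]]]] := bruhat_mx (det_GL g).
exists (uni x y z); first exact: uni_in.
by exists (uni x' y' z'); rewrite ?uni_in // !GLvalM !uniE.
Qed.

End GL3.

(** * Power sums over a finite field *)

Section PowerSums.

Variable k : finFieldType.
Local Notation q := #|k|.

Lemma card_gt1 : (1 < q)%N.
Proof. by rewrite (cardD1 0) (cardD1 1) !inE oner_eq0. Qed.

Lemma expf_card_pred (a : k) : a != 0 -> a ^+ q.-1 = 1.
Proof.
move=> a0; apply: (mulfI a0); rewrite -exprS prednK ?expf_card ?mulr1 //.
exact: ltnW card_gt1.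
Qed.

(** Translating by 1 permutes k, so the sum of its elements equals itself plus
    q. *)
Lemma natf_card : q%:R = 0 :> k.
Proof.
have e : \sum_(a : k) a = \sum_(a : k) (a + 1).
  by rewrite (reindex_inj (addIr (1 : k))).
by apply: (addrI (\sum_(a : k) a)); rewrite addr0 {2}e big_split /= sumr_const.
Qed.

(** Multiplying the variable by b multiplies the sum by b ^ m, and the polynomial
    X ^ m - 1 has too few roots for b ^ m = 1 to hold for all nonzero b. *)
Lemma sum_expf_lt m : (m < q.-1)%N -> \sum_(a : k) a ^+ m = 0.
Proof.
case: m => [|m] mq.
  by rewrite (eq_bigr (fun=> 1)) ?sumr_const ?natf_card // => a; rewrite expr0.
have [b /andP[b0 bm]] : exists b : k, (b != 0) && (b ^+ m.+1 != 1).
  apply/existsP; apply: contraLR mq; rewrite negb_exists => /forallP h.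
  have sP : size ('X^(m.+1) - 1 : {poly k}) = m.+2 by rewrite -polyC1 size_XnsubC.
  have Pn0 : 'X^(m.+1) - 1 != 0 :> {poly k} by rewrite -size_poly_eq0 sP.
  have := max_poly_roots (rs := enum [pred a : k | a != 0]) Pn0.
  rewrite sP -cardE cardC1 ltnS -leqNgt => -> //; last exact: enum_uniq.
  apply/allP => a; rewrite mem_enum inE => a0; have := h a.
  by rewrite a0 negbK rootE !hornerE => /eqP ->; rewrite subrr.
have : \sum_(a : k) a ^+ m.+1 = b ^+ m.+1 * \sum_(a : k) a ^+ m.+1.
  rewrite mulr_sumr (reindex_inj (mulfI b0)) /=.
  by apply: eq_bigr => a _; rewrite exprMn.
move/eqP; rewrite -{1}[\sum_a _]mul1r -subr_eq0 -mulrBl mulf_eq0 subr_eq0.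
by rewrite eq_sym (negbTE bm) => /eqP.
Qed.

Lemma sum_expf_pred : \sum_(a : k) a ^+ q.-1 = -1.
Proof.
have q1 : (0 < q.-1)%N by have := card_gt1; case: #|k| => [|[]].
rewrite (bigD1 0) //= expr0n eqn0Ngt q1 add0r.
rewrite (eq_bigr (fun=> 1)) => [|a a0]; last exact: expf_card_pred.
rewrite sumr_const cardC1 -subn1 natrB ?natf_card ?sub0r //.
exact: ltnW card_gt1.
Qed.

(** Up to degree 2 (q - 1) - 1 only the monomial of degree q - 1 contributes: the
    monomials of higher degree fold back, as a ^ q = a, to a degree strictly
    between 0 and q - 1. *)
Lemma sum_horner (p : {poly k}) : (size p <= q.-1.*2)%N ->
  \sum_(t : k) p.[t] = - p`_q.-1.
Proof.
have q1 : (0 < q.-1)%N by have := card_gt1; case: #|k| => [|[]].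
move=> sp; under eq_bigr => t _ do rewrite (horner_coef_wide t sp).
have lq : (q.-1 < q.-1.*2)%N by rewrite -addnn -{1}[q.-1]addn0 ltn_add2l.
rewrite exchange_big /= (bigD1 (Ordinal lq)) //= -mulr_sumr sum_expf_pred mulrN1.
rewrite big1 ?addr0 // => i.
rewrite -val_eqE /= => iq; rewrite -mulr_sumr.
case: (ltngtP i q.-1) iq => // iq _; first by rewrite sum_expf_lt ?mulr0.
have [j ij jq] : exists2 j : nat, i = (j.+1 + q.-1)%N :> nat & (j.+1 < q.-1)%N.
  exists (i - q.-1).-1; rewrite prednK ?subn_gt0 // ?subnK ?(ltnW iq) //.
  by rewrite ltn_subLR ?(ltnW iq) // addnn ltn_ord.
rewrite ij (eq_bigr (fun t : k => t ^+ j.+1)) ?sum_expf_lt ?mulr0 // => t _.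
have [->|t0] := eqVneq t 0; first by rewrite !expr0n addSn.
by rewrite exprD expf_card_pred // mulr1.
Qed.

Lemma sum_horner_eq0 (p : {poly k}) : (size p <= q.-1)%N ->
  \sum_(t : k) p.[t] = 0.
Proof.
move=> sp; rewrite sum_horner; first by rewrite nth_default ?oppr0.
by rewrite -addnn (leq_trans sp) ?leq_addr.
Qed.

End PowerSums.

(** * The relations imposed when q > 2 *)

Section HeckeOps.

Variables (k : finFieldType) (F : fieldType).
Local Notation G := {'GL_3[k]}.
Local Notation U := (unitri_group k).
Local Notation V := {ffun G -> F^o}.

Implicit Types (a b c p q r : k) (g x y : G).

(** The representatives s_1 u(a) and s_2 u(a) of the double cosets U s_i U modulo
    U, for lifts s_i of the simple reflections to SL_3. *)
Definition rep_s1 a : G := gl3 (mx3 0 (-1) 0 1 a 0 0 0 1).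
Definition rep_s2 a : G := gl3 (mx3 1 0 0 0 0 (-1) 0 1 a).
Definition tor p q r : G := gl3 (mx3 p 0 0 0 q 0 0 0 r).

Lemma rep_s1E a : GLval (rep_s1 a) = mx3 0 (-1) 0 1 a 0 0 0 1.
Proof.
apply/gl3E/unitmx_det; rewrite det_mx3; set d := (X in X != 0).
by rewrite (_ : d = 1) ?oner_eq0 // /d; ring.
Qed.

Lemma rep_s2E a : GLval (rep_s2 a) = mx3 1 0 0 0 0 (-1) 0 1 a.
Proof.
apply/gl3E/unitmx_det; rewrite det_mx3; set d := (X in X != 0).
by rewrite (_ : d = 1) ?oner_eq0 // /d; ring.
Qed.

Lemma torE p q r : p * q * r != 0 ->
  GLval (tor p q r) = mx3 p 0 0 0 q 0 0 0 r.
Proof.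
move=> pqr; apply/gl3E/unitmx_det; rewrite det_mx3.
by rewrite !(mul0r, mulr0, subr0, addr0) mulrA.
Qed.

Lemma rep_s1_uni a (x y z : k) :
  (rep_s1 a * uni x y z)%g = (uni 0%R (- z)%R (y + a * z)%R * rep_s1 (a + x)%R)%g.
Proof.
apply: GLval_inj; rewrite !GLvalM !rep_s1E !uniE /unimx !mx3M; congr mx3; ring.
Qed.

Lemma rep_s2_uni a (x y z : k) :
  (rep_s2 a * uni x y z)%g = (uni (x * (a + z) - y)%R x 0%R * rep_s2 (a + z)%R)%g.
Proof.
apply: GLval_inj; rewrite !GLvalM !rep_s2E !uniE /unimx !mx3M; congr mx3; ring.
Qed.

Lemma tor_uni p q r (x y z : k) : p * q * r != 0 ->
  (tor p q r * uni x y z)%g =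
  (uni (p * x / q)%R (p * y / r)%R (q * z / r)%R * tor p q r)%g.
Proof.
move=> pqr; have := pqr; rewrite !mulf_eq0 !negb_or => /andP[/andP[p0 q0] r0].
apply: GLval_inj; rewrite !GLvalM !torE // !uniE /unimx !mx3M.
by congr mx3; field; do ?[apply/andP; split].
Qed.

Definition op_s1 : seq (F * G) := [seq (1, rep_s1 a) | a <- enum k].
Definition op_s2 : seq (F * G) := [seq (1, rep_s2 a) | a <- enum k].

Lemma ltcomb_s1 (f : V) x : ltcomb op_s1 f x = \sum_a (f (rep_s1 a * x)%g : F).
Proof.
rewrite ffunE big_map big_enum; apply: eq_bigr => a _; exact: mul1r.
Qed.

Lemma ltcomb_s2 (f : V) x : ltcomb op_s2 f x = \sum_a (f (rep_s2 a * x)%g : F).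
Proof.
rewrite ffunE big_map big_enum; apply: eq_bigr => a _; exact: mul1r.
Qed.

Lemma stable_s1 : stable U op_s1.
Proof.
move=> f /ind1P fU; apply/ind1P => _ g /unitriP[x [y [z ->]]].
rewrite !ltcomb_s1 [RHS](reindex_inj (addIr x)) /=; apply: eq_bigr => a _.
by rewrite mulgA rep_s1_uni -mulgA fU ?uni_in.
Qed.

Lemma stable_s2 : stable U op_s2.
Proof.
move=> f /ind1P fU; apply/ind1P => _ g /unitriP[x [y [z ->]]].
rewrite !ltcomb_s2 [RHS](reindex_inj (addIr z)) /=; apply: eq_bigr => a _.
by rewrite mulgA rep_s2_uni -mulgA fU ?uni_in.
Qed.

Variable iota : {rmorphism k -> F}.

(** Translation by a torus element minus the value of the character that takes its
    middle entry; triples with a zero entry impose nothing. *)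
Definition op_torus p q r : seq (F * G) :=
  if p * q * r == 0 then [::] else [:: (1, tor p q r); (- iota q, 1%g)].

Lemma ltcomb_torus p q r (f : V) x : p * q * r != 0 ->
  ltcomb (op_torus p q r) f x = f (tor p q r * x)%g - iota q * (f x : F).
Proof.
move=> pqr; rewrite ffunE /op_torus (negbTE pqr) !big_cons big_nil /= addr0 mul1g.
by rewrite mulNr mul1r.
Qed.

Lemma stable_torus p q r : stable U (op_torus p q r).
Proof.
move=> f /ind1P fU; apply/ind1P => _ g /unitriP[x [y [z ->]]].
have [pqr|pqr] := eqVneq (p * q * r) 0.
  by rewrite !ffunE /op_torus pqr eqxx !big_nil.
rewrite ltcomb_torus // ltcomb_torus // mulgA tor_uni // -mulgA fU; last exact: uni_in.
by rewrite (fU (uni x y z)) ?uni_in.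
Qed.

Definition weight_rels (i : (k * k * k + bool)%type) : hecke F U :=
  match i with
  | inl (p, q, r) => hecke_ltcomb (@stable_torus p q r)
  | inr true => hecke_ltcomb stable_s1
  | inr false => hecke_ltcomb stable_s2
  end.

End HeckeOps.

(** * Bi-invariant functions that satisfy the relations *)

Section NonFlat.

Variables (k : finFieldType) (F : fieldType) (iota : {rmorphism k -> F}).
Local Notation G := {'GL_3[k]}.
Local Notation U := (unitri_group k).
Local Notation V := {ffun G -> F^o}.
Local Notation q := #|k|.
Hypothesis q_gt2 : (2 < q)%N.

Local Notation M := (q - 2)%N.

Implicit Types (a b c p r : k) (g x y : G).

Lemma succ_card_sub2 : M.+1 = q.-1.
Proof. by move: q_gt2; case: #|k| => [|[|n]] // _; rewrite subn2. Qed.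

(** Two coordinates of the vector product of the last two rows. *)
Definition phi1 (A : 'M[k]_3) := A i1 i2 * A i2 i0 - A i1 i0 * A i2 i2.
Definition phi2 (A : 'M[k]_3) := A i1 i0 * A i2 i1 - A i1 i1 * A i2 i0.

Lemma phi2_unimx (A : 'M[k]_3) (x y z x' y' z' : k) :
  phi2 (unimx x y z *m A *m unimx x' y' z') = phi2 A.
Proof.
rewrite (mx3_eta A) /unimx !mx3M /phi2 !mxE /=; ring.
Qed.

Lemma row2_unimx (A : 'M[k]_3) (x y z x' y' z' : k) :
  (unimx x y z *m A *m unimx x' y' z') i2 i0 = A i2 i0.
Proof.
rewrite (mx3_eta A) /unimx !mx3M !mxE /=; ring.
Qed.

Section Annihilated.

Variable m : V.
Hypothesis mUl : forall u x, u \in U -> m (u * x)%g = m x.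
Hypothesis mUr : forall u x, u \in U -> m (x * u)%g = m x.
Hypothesis mT : forall p s r x, p * s * r != 0 ->
  m (tor p s r * x)%g = iota s * (m x : F).
Hypothesis m_s1 : forall x, \sum_a (m (rep_s1 a * x)%g : F) = 0.
Hypothesis m_s2 : forall x, \sum_a (m (rep_s2 a * x)%g : F) = 0.

(** The rank one identity that writes a lower unipotent matrix as an element of
    U T s U. *)
Lemma rep_s1_lower a : a != 0 -> (rep_s1 a * (rep_s1 0)^-1 =
  uni (- a^-1)%R 0%R 0%R * tor (- a^-1)%R (- a)%R 1%R * rep_s1 0%R
    * uni (- a^-1)%R 0%R 0%R)%g.
Proof.
move=> a0; apply: (canLR (mulgK _)).
have ta : - a^-1 * - a * 1 != 0 by rewrite mulr1 mulrNN mulVf ?oner_eq0.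
apply: GLval_inj; rewrite !GLvalM !rep_s1E torE // !uniE /unimx !mx3M.
by congr mx3; field.
Qed.

Lemma rep_s2_lower a : a != 0 -> (rep_s2 a * (rep_s2 0)^-1 =
  uni 0%R 0%R (- a^-1)%R * tor 1%R (- a^-1)%R (- a)%R * rep_s2 0%R
    * uni 0%R 0%R (- a^-1)%R)%g.
Proof.
move=> a0; apply: (canLR (mulgK _)).
have ta : 1 * - a^-1 * - a != 0 by rewrite mul1r mulrNN mulVf ?oner_eq0.
apply: GLval_inj; rewrite !GLvalM !rep_s2E torE // !uniE /unimx !mx3M.
by congr mx3; field.
Qed.

Lemma sum_id : \sum_(a : k) a = 0.
Proof.
have q1 : (1 < q.-1)%N by rewrite -subn1 ltn_subRL.
by rewrite -[RHS](sum_expf_lt q1); apply: eq_bigr => a _; rewrite expr1.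
Qed.

(** If s_1 x is longer than x, the sum defining T_1 m at s_1^-1 x consists of m x
    and of the terms for a <> 0, which all equal m (s_1 x) up to the weight - a.
    These weights sum to zero as q > 2, so m x = 0. *)
Lemma ascent1 x :
  (forall c, exists2 u, u \in U & (uni c 0%R 0%R * x = x * u)%g) -> m x = 0.
Proof.
move=> asc; have := m_s1 ((rep_s1 0)^-1 * x)%g; rewrite (bigD1 0) //= mulgA mulgV mul1g.
rewrite (eq_bigr (fun a => iota (- a) * (m (rep_s1 0 * x)%g : F))) => [|a a0].
  rewrite -mulr_suml (_ : \sum_(_ | _) _ = 0) ?mul0r ?addr0 //.
  rewrite -raddf_sum (_ : \sum_(_ | _) _ = 0) ?raddf0 // sumrN.
  have := sum_id; rewrite (bigD1 0) //= add0r => ->; exact: oppr0.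
have [u uU ux] := asc (- a^-1).
have ta : - a^-1 * - a * 1 != 0 by rewrite mulr1 mulrNN mulVf ?oner_eq0.
rewrite mulgA rep_s1_lower // -!mulgA ux mUl ?uni_in // mT //.
by rewrite !mulgA (mUr _ uU).
Qed.

Lemma ascent2 x :
  (forall c, exists2 u, u \in U & (uni 0%R 0%R c * x = x * u)%g) -> m x = 0.
Proof.
move=> asc; have := m_s2 ((rep_s2 0)^-1 * x)%g; rewrite (bigD1 0) //= mulgA mulgV mul1g.
rewrite (eq_bigr (fun a => iota (- a^-1) * (m (rep_s2 0 * x)%g : F))) => [|a a0].
  rewrite -mulr_suml (_ : \sum_(_ | _) _ = 0) ?mul0r ?addr0 //.
  rewrite -raddf_sum (_ : \sum_(_ | _) _ = 0) ?raddf0 // sumrN.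
  have := sum_id; rewrite (reindex_inj invr_inj) (bigD1 0) //= invr0 add0r => ->.
  exact: oppr0.
have [u uU ux] := asc (- a^-1).
have ta : 1 * - a^-1 * - a != 0 by rewrite mul1r mulrNN mulVf ?oner_eq0.
rewrite mulgA rep_s2_lower // -!mulgA ux mUl ?uni_in // mT //.
by rewrite !mulgA (mUr _ uU).
Qed.

Definition longest : G := gl3 (mx3 0 0 1 0 1 0 1 0 0).

Lemma longestE : GLval longest = mx3 0 0 1 0 1 0 1 0 0.
Proof.
apply/gl3E/unitmx_det; rewrite det_mx3; set d := (X in X != 0).
by rewrite (_ : d = -1) ?oppr_eq0 ?oner_eq0 // /d; ring.
Qed.

(** Every monomial matrix is an ascent for s_1 or s_2 except those of the longest
    Weyl element, and on the big cell m is determined by its weight. *)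
Lemma annihilated_fun x :
  m x = - (m longest : F) * iota (GLval x i2 i0 ^+ M * phi2 (GLval x)).
Proof.
have M0 : (0 < M)%N by rewrite subn_gt0.
have [u uU [u' u'U mon]] := bruhat x.
have [a [b [c eu]]] := unitriP _ uU; have [a' [b' [c' eu']]] := unitriP _ u'U.
rewrite -(mUl x uU) -(mUr (u * x)%g u'U).
rewrite -(row2_unimx (GLval x) a b c a' b' c') -(phi2_unimx (GLval x) a b c a' b' c').
rewrite -!uniE -eu -eu' -!GLvalM; move: (u * x * u')%g mon => {}x mon.
have dx := det_GL x.
have [N mN ex] : exists2 N, monomial N & GLval x = N by exists (GLval x).
case: N / mN ex => p s r ex; rewrite /phi2 ex !mxE /=;
  rewrite ex det_mx3 !(mul0r, mulr0, subr0, sub0r, addr0, add0r) in dx *.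
all: move: dx; rewrite ?oppr0 ?add0r ?mulrN ?oppr_eq0 !mulf_eq0 !negb_or.
all: case/and3P=> p0 s0 r0.
all: rewrite ?(oppr0, mulr0) ?[0 ^+ M]expr0n ?(gtn_eqF M0) ?(mul0r, rmorph0, mulr0).
- apply: ascent1 => e; exists (uni (e * s / p) 0 0); first exact: uni_in.
  by apply: GLval_inj; rewrite !GLvalM !uniE ex /unimx !mx3M; congr mx3; field.
- apply: ascent1 => e; exists (uni 0 (e * s / p) 0); first exact: uni_in.
  by apply: GLval_inj; rewrite !GLvalM !uniE ex /unimx !mx3M; congr mx3; field.
- apply: ascent2 => e; exists (uni 0 (e * r / s) 0); first exact: uni_in.
  by apply: GLval_inj; rewrite !GLvalM !uniE ex /unimx !mx3M; congr mx3; field.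
- apply: ascent1 => e; exists (uni 0 0 (e * s / p)); first exact: uni_in.
  by apply: GLval_inj; rewrite !GLvalM !uniE ex /unimx !mx3M; congr mx3; field.
- apply: ascent2 => e; exists (uni (e * r / s) 0 0); first exact: uni_in.
  by apply: GLval_inj; rewrite !GLvalM !uniE ex /unimx !mx3M; congr mx3; field.
have psr : p * s * r != 0 by rewrite !mulf_neq0.
have -> : x = (tor p s r * longest)%g.
  apply: GLval_inj; rewrite GLvalM torE // longestE ex mx3M; congr mx3; ring.
rewrite mT // mulrCA -exprSr succ_card_sub2 expf_card_pred // mulr1.
by rewrite rmorphN mulrNN mulrC.
Qed.

End Annihilated.
End NonFlat.

(** * A relation that does not come from the Hecke algebra *)

Section Witness.

Variables (k : finFieldType) (F : fieldType) (iota : {rmorphism k -> F}).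
Local Notation G := {'GL_3[k]}.
Local Notation U := (unitri_group k).
Local Notation V := {ffun G -> F^o}.
Local Notation q := #|k|.
Hypothesis q_gt2 : (2 < q)%N.
Local Notation M := (q - 2)%N.
Implicit Types (a b c p r : k) (g x y : G).

Definition witness_fun : V :=
  [ffun x : G => iota (GLval x i2 i0 ^+ M.-1 * GLval x i2 i1 * phi1 (GLval x))].

Fact witness_ind1 : witness_fun \in ind1 F U.
Proof.
apply/ind1P => _ x /unitriP[a [b [c ->]]]; rewrite !ffunE; congr (iota _).
rewrite GLvalM uniE [GLval x]mx3_eta /unimx mx3M /phi1 !mxE /=.
by congr (_ ^+ _ * _ * _); ring.
Qed.

Definition witness : ind1_mod F U := ind1_elt witness_ind1.

Lemma witness_torus p s r : p * s * r != 0 ->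
  ltcomb (op_torus iota p s r) witness_fun = 0.
Proof.
move=> psr; apply/ffunP => x; rewrite ltcomb_torus // !ffunE -rmorphM -rmorphB.
rewrite GLvalM torE // [GLval x]mx3_eta mx3M /phi1 !mxE /=.
rewrite !(mul0r, add0r, addr0) !exprMn.
have r0 : r != 0 by apply: contraNneq psr => ->; rewrite mulr0.
have rM : r ^+ M.-1 * r * r = 1.
  by rewrite -!exprSr prednK ?subn_gt0 // (succ_card_sub2 q_gt2) expf_card_pred.
set w := (X in iota X); rewrite (_ : w = 0) ?rmorph0 // /w.
move: (_ ^+ M.-1) rM => rr rM; move: (_ ^+ M.-1) => v.
move: (GLval x i2 i0) (GLval x i2 i1) (GLval x i2 i2) => v0 v1 v2.
move: (GLval x i1 i0) (GLval x i1 i1) (GLval x i1 i2) => y0 y1 y2.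
transitivity ((rr * r * r - 1) * s * v * v1 * (y2 * v0 - y0 * v2)); first by ring.
by rewrite rM subrr !mul0r.
Qed.

Lemma leq_predn m n : (m <= n)%N -> (m.-1 <= n.-1)%N.
Proof. by case: m n => [|m] [|n]. Qed.

Lemma size_lin (a b : k) : (size (a%:P + b%:P * 'X)%R <= 2)%N.
Proof.
rewrite (leq_trans (size_polyD _ _)) // geq_max (leq_trans (size_polyC_leq1 _)) //=.
by rewrite mul_polyC (leq_trans (size_scale_leq _ _)) // size_polyX.
Qed.

Lemma size_lin_exp (a b : k) n : (size ((a%:P + b%:P * 'X) ^+ n)%R <= n.+1)%N.
Proof.
apply: (leq_trans (size_poly_exp_leq _ _)); rewrite ltnS.
by have := size_lin a b; case: size => [|s] sl; rewrite ?mul0n // -[leqRHS]mul1n leq_mul.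
Qed.

Lemma witness_s1 : ltcomb (op_s1 k F) witness_fun = 0.
Proof.
apply/ffunP => x; rewrite ltcomb_s1 !ffunE.
under eq_bigr do rewrite ffunE GLvalM rep_s1E [GLval x]mx3_eta mx3M /phi1 !mxE /=.
rewrite -raddf_sum /=; set v0 := GLval x i2 i0; set v1 := GLval x i2 i1.
set v2 := GLval x i2 i2.
pose P : {poly k} := (v0 ^+ M.-1 * v1)%:P *
  (((GLval x i0 i2)%:P + (GLval x i1 i2)%:P * 'X) * v0%:P
    - ((GLval x i0 i0)%:P + (GLval x i1 i0)%:P * 'X) * v2%:P).
rewrite (eq_bigr (horner P)) => [|a _]; last first.
  by rewrite /P !hornerE /=; move: (_ ^+ _) => w; ring.
rewrite sum_horner_eq0 ?rmorph0 //.
have sC (Q : {poly k}) (a : k) : (size Q <= 2 -> size (Q * a%:P)%R <= 2)%N.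
  by move=> sQ; rewrite mulrC mul_polyC (leq_trans (size_scale_leq _ _)).
apply: (@leq_trans 2); last by rewrite -(succ_card_sub2 q_gt2) ltnS subn_gt0.
rewrite /P mulrC; apply: (sC); rewrite (leq_trans (size_polyD _ _)) // geq_max.
by rewrite size_polyN !sC ?size_lin.
Qed.

Lemma witness_s2 : ltcomb (op_s2 k F) witness_fun = 0.
Proof.
apply/ffunP => x; rewrite ltcomb_s2 !ffunE.
under eq_bigr do rewrite ffunE GLvalM rep_s2E [GLval x]mx3_eta mx3M /phi1 !mxE /=.
rewrite -raddf_sum /=; set v0 := GLval x i2 i0; set v1 := GLval x i2 i1.
set v2 := GLval x i2 i2.
pose P : {poly k} := ((GLval x i1 i0)%:P + v0%:P * 'X) ^+ M.-1 *
  ((GLval x i1 i1)%:P + v1%:P * 'X).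
pose c := GLval x i1 i2 * v0 - GLval x i1 i0 * v2.
rewrite (eq_bigr (fun a => P.[a] * c)) => [|a _]; last first.
  rewrite /P !hornerE /= /c; by congr (_ * _); [congr (_ ^+ _ * _); ring|ring].
rewrite -mulr_suml sum_horner_eq0 ?mul0r ?rmorph0 //.
apply: (leq_trans (size_polyMleq _ _)).
apply: (leq_trans (n := (M.-1.+1 + 2).-1)).
  by rewrite leq_predn // leq_add ?size_lin_exp ?size_lin.
by rewrite prednK ?subn_gt0 // addn2 /= (succ_card_sub2 q_gt2).
Qed.

(** Here (v, phi) is ((1, t, 0), (-t, 1, 0)) and ((1, 0, t), (-t, 0, 1)). *)
Definition linea t : G := gl3 (mx3 0 1 0 0 0 1 1 t 0).
Definition lineb t : G := gl3 (mx3 0 0 1 0 (-1) 0 1 0 t).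

Lemma lineaE t : GLval (linea t) = mx3 0 1 0 0 0 1 1 t 0.
Proof.
apply/gl3E/unitmx_det; rewrite det_mx3; set d := (X in X != 0).
by rewrite (_ : d = 1) ?oner_eq0 // /d; ring.
Qed.

Lemma linebE t : GLval (lineb t) = mx3 0 0 1 0 (-1) 0 1 0 t.
Proof.
apply/gl3E/unitmx_det; rewrite det_mx3; set d := (X in X != 0).
by rewrite (_ : d = 1) ?oner_eq0 // /d; ring.
Qed.

(** On a polynomial sum_j F_j(v) phi_j of degree q - 2 in v, the power sums extract
    the coefficients of t in - t F_0 + F_1 and - t F_0 + F_2 along the two lines of
    flags.  As q - 2 = -2 in k, the sum of these is the coefficient of
    v_0 ^ (q - 3) in the divergence, so this form is minus that coefficient. *)
Definition divergence (f : V) : F^o :=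
  \sum_(t : k) iota (t ^+ M) * ((f (linea t) : F) + (f (lineb t) : F)).

Fact divergence_is_linear : linear divergence.
Proof.
move=> a f h; rewrite /divergence scaler_sumr -big_split /=; apply: eq_bigr => t _.
rewrite !ffunE /GRing.scale /=; ring.
Qed.
HB.instance Definition _ := GRing.isLinear.Build F V F^o _ divergence divergence_is_linear.

Lemma divergence_witness : divergence witness_fun = -1.
Proof.
rewrite /divergence (eq_bigr (fun t => iota (t ^+ q.-1))) => [|t _].
  by rewrite -rmorph_sum sum_expf_pred rmorphN1.
rewrite !ffunE lineaE linebE /phi1 !mxE /= expr1n -rmorphD -rmorphM; congr (iota _).
by rewrite -(succ_card_sub2 q_gt2) exprSr; move: (_ ^+ _) => w; ring.
Qed.

Lemma coef1_lin_exp (a b : k) n :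
  ((a%:P + b%:P * 'X) ^+ n)`_0 = a ^+ n /\
  ((a%:P + b%:P * 'X) ^+ n)`_1 = n%:R * a ^+ n.-1 * b.
Proof.
elim: n => [|n [IH0 IH1]].
  by rewrite expr0 !coefE /= !mul0r.
rewrite exprS mulrDl -mulrA !coefD !coefCM !coefXM /= IH0 IH1 mulr0 addr0 -exprS.
split=> //; case: n {IH0 IH1} => [|n] /=; rewrite ?expr0 ?exprS -?[in RHS]natr1; ring.
Qed.

Lemma sum_power_lin (a b c d : k) :
  \sum_(t : k) t ^+ M * ((a + b * t) ^+ M * (c + d * t)) =
  - (M%:R * a ^+ M.-1 * b * c + a ^+ M * d).
Proof.
pose P : {poly k} := 'X^M * ((a%:P + b%:P * 'X) ^+ M * (c%:P + d%:P * 'X)).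
rewrite (eq_bigr (horner P)) => [|t _]; last by rewrite /P !hornerE.
rewrite sum_horner.
  rewrite /P coefXnM -(succ_card_sub2 q_gt2) ltnNge leqnSn /= subSnn.
  rewrite mulrDr mulrA !coefD coefMC coefMX /= coefMC.
  by have [-> ->] := coef1_lin_exp a b M; congr (- (_ + _)); rewrite mulrC.
apply: (leq_trans (size_polyMleq _ _)); rewrite size_polyXn /=.
apply: (leq_trans (n := M + (M.+1 + 2).-1)).
  rewrite leq_add2l (leq_trans (size_polyMleq _ _)) // leq_predn //.
  by rewrite leq_add ?size_lin_exp ?size_lin.
by rewrite -(succ_card_sub2 q_gt2) addn2 /= -addnn !addSn !addnS.
Qed.

(** The translate by g is l(v) ^ (q - 2) lambda(phi), with l the first column of g
    and lambda the vector product of its first two columns; its divergence is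
    proportional to lambda(l) = 0. *)
Lemma divergence_rtrans (kappa : F) (m : V) g :
  (forall x, m x = kappa * iota (GLval x i2 i0 ^+ M * phi2 (GLval x))) ->
  divergence (rtrans g m) = 0.
Proof.
move=> mE; rewrite /divergence.
pose A i j := GLval g i j.
pose B := A i2 i0 * A i1 i1 - A i2 i1 * A i1 i0.
pose Pa t := t ^+ M * ((A i0 i0 + A i1 i0 * t) ^+ M *
   ((A i2 i0 * A i0 i1 - A i2 i1 * A i0 i0) + B * t)).
pose Pb t := t ^+ M * ((A i0 i0 + A i2 i0 * t) ^+ M *
   ((A i1 i1 * A i0 i0 - A i1 i0 * A i0 i1) + B * t)).
rewrite (eq_bigr (fun t => kappa * iota (Pa t + Pb t))) => [|t _].
  rewrite -mulr_sumr -raddf_sum big_split /= !sum_power_lin.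
  set w := (X in iota X); suff -> : w = 0 by rewrite rmorph0 mulr0.
  have M0 : (0 < M)%N by rewrite subn_gt0.
  have M2 : M%:R = - 2%:R :> k by rewrite natrB ?natf_card ?sub0r // ltnW.
  rewrite /w /B M2 -{2 4}(prednK M0) exprS; move: (_ ^+ M.-1) => v; ring.
rewrite !ffunE !mE !GLvalM lineaE linebE [GLval g]mx3_eta !mx3M /phi2 !mxE /=.
rewrite -mulrDr -rmorphD mulrCA -rmorphM; congr (kappa * iota _).
by rewrite /Pa /Pb /B /A -[RHS]mulrDr; congr (_ * (_ ^+ _ * _ + _ ^+ _ * _)); ring.
Qed.

Lemma not_flat_of_card_gt2 : ~ flat (ind1_mod F U : lmodType (hecke F U)).
Proof.
move=> flatC.
have zero : (divergence \o @ind1_fun F _ U) witness = 0.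
  apply: (flat_relation (h := @weight_rels k F iota) flatC).
    case=> [[[p s] r]|[]]; apply: ind1_fun_inj; rewrite hecke_ltcombE raddf0.
    - have [psr|psr] := eqVneq (p * s * r) 0; last exact: witness_torus.
      by apply/ffunP => x; rewrite !ffunE /op_torus psr eqxx big_nil.
    - exact: witness_s1.
    - exact: witness_s2.
  move=> h hann c /=; set m := ind1_fun (h *: delta F U).
  have rel i : ind1_fun (weight_rels iota i *: (h *: delta F U)) = 0.
    by rewrite scalerA hann scale0r raddf0.
  have mE := annihilated_fun (iota := iota) q_gt2 (m := m).
  rewrite hecke_delta linear_sum big1 // => X _; rewrite linearZ /=.
  rewrite (divergence_rtrans (kappa := - (m (longest k) : F))); first exact: mulr0.
  apply: mE => [u x uU|u x uU|p s r x psr|x|x].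
  - by rewrite /m ind1_funUl.
  - by rewrite /m hecke_delta_rinv.
  - have /ffunP/(_ x) := rel (inl (p, s, r)).
    by rewrite hecke_ltcombE ltcomb_torus // ffunE => /eqP; rewrite subr_eq0 => /eqP.
  - have /ffunP/(_ x) := rel (inr true).
    by rewrite hecke_ltcombE ltcomb_s1 ffunE.
  - have /ffunP/(_ x) := rel (inr false).
    by rewrite hecke_ltcombE ltcomb_s2 ffunE.
have := divergence_witness; rewrite -[divergence _]/((divergence \o @ind1_fun F _ U) witness) zero.
by move/eqP; rewrite eq_sym oppr_eq0 oner_eq0.
Qed.

End Witness.

(** * A finite computation over the field with two elements *)

Section BoolMatrices.

(** A 3 x 3 matrix over the field with two elements is the list of its nine
    entries, row by row. *)
Definition bmx := seq bool.
Implicit Types (X Y Z : bmx) (L : seq bmx).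

Definition bmul X Y : bmx :=
  [seq (nth false X (3 * i) && nth false Y j)
   (+) (nth false X (3 * i).+1 && nth false Y (3 + j))
   (+) (nth false X (3 * i).+2 && nth false Y (6 + j)) | i <- iota 0 3, j <- iota 0 3].

Definition bone : bmx := [:: true; false; false; false; true; false; false; false; true].
Definition buni (a b c : bool) : bmx :=
  [:: true; a; b; false; true; c; false; false; true].
Definition bunis : seq bmx :=
  [seq buni p.1.1 p.1.2 p.2 | p <- [:: (false, false, false); (true, false, false);
    (false, true, false); (true, true, false); (false, false, true);
    (true, false, true); (false, true, true); (true, true, true)]].

(** The elements of order 3 that generate the group K of order 21; tau fixes the
    last row of the matrices that it multiplies, sigma fixes phi. *)
Definition btau : bmx := [:: false; true; false; true; true; false; false; false; true].
Definition bsigma : bmx := [:: true; false; true; false; false; true; false; true; true].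

(** The two translations whose sum is T_1 (for false) or T_2 (for true). *)
Definition bgen (b : bool) : seq bmx :=
  if b then [:: bsigma; bmul bsigma bsigma] else [:: btau; bmul btau btau].

(** The translations that make up the product of the T_b along a word.  The order
    of multiplication is reversed, since left translations of functions compose
    contravariantly. *)
Fixpoint bword (w : seq bool) : seq bmx :=
  if w is b :: w' then [seq bmul X' X | X <- bgen b, X' <- bword w'] else [:: bone].

Definition bwords (ws : seq (seq bool)) : seq bmx := flatten [seq bword w | w <- ws].

(** Equality in the group algebra over the field with two elements. *)
Definition parity_eq L L' :=
  all (fun X => odd (count_mem X L) == odd (count_mem X L')) (L ++ L').

(** The six reduced words w, each with the words whose sum is the element
    Tbar_(w^-1 w0) of the dual basis, expanded with T_i^2 = T_i. *)
Definition casimir : seq (seq bool * seq (seq bool)) :=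
  let s := false in let t := true in
  [:: ([::], [:: [::]; [:: s]; [:: t]; [:: s; t]; [:: t; s]; [:: s; t; s]]);
      ([:: s], [:: [::]; [:: s]; [:: t]; [:: t; s]]);
      ([:: t], [:: [::]; [:: s]; [:: t]; [:: s; t]]);
      ([:: s; t], [:: [::]; [:: s]]);
      ([:: t; s], [:: [::]; [:: t]]);
      ([:: s; t; s], [:: [::]])].

(** Theta = 1 + g + g^-1 with g = tau sigma: a solution, with few terms, of the
    linear system that the identity below is for an unknown Theta in the group
    algebra of K. *)
Definition btheta : seq bmx :=
  let g := bmul btau bsigma in
  [:: bone; g; bmul (bmul bsigma bsigma) (bmul btau btau)].

Definition higman_pairs : seq (bmx * bmx) :=
  flatten [seq [seq (X', X) | X' <- bword p.1, X <- bwords p.2] | p <- casimir].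

(** The identity sum_w Tbar_(w^-1 w0) Theta T_w = 1, in the group algebra of K. *)
Lemma higman_check :
  parity_eq [seq bmul (bmul r.1 Z) r.2 | r <- higman_pairs, Z <- btheta] [:: bone].
Proof. by vm_compute. Qed.

(** The group K: five rounds of multiplication by the generators are enough. *)
Definition bK : seq bmx :=
  iter 5 (fun L => undup (L ++ [seq bmul X Y | X <- bgen false ++ bgen true, Y <- L]))
    [:: bone].

Definition bperms : seq bmx :=
  let t := true in let f := false in
  [:: [:: t; f; f; f; t; f; f; f; t]; [:: f; t; f; t; f; f; f; f; t];
      [:: t; f; f; f; f; t; f; t; f]; [:: f; f; t; t; f; f; f; t; f];
      [:: f; t; f; f; f; t; t; f; f]; [:: f; f; t; f; t; f; t; f; f]].

Definition bisuni X : bool := X \in bunis.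

(** All elements of GL_3 over the field with two elements have order dividing
    84. *)
Definition binvertible X := bmul X (iter 83 (bmul X) bone) == bone.

Lemma invertible_bunis : all binvertible bunis. Proof. by vm_compute. Qed.
Lemma invertible_bK : all binvertible bK. Proof. by vm_compute. Qed.
Lemma invertible_bperms : all binvertible bperms. Proof. by vm_compute. Qed.
Lemma K_check :
  [/\ all (fun X => all (fun Y => bmul X Y \in bK) bK) bK,
      uniq bK, all (fun X => X \in bK) btheta, bone \in bK
    & all (fun p : seq bool * seq (seq bool) => all (fun X => X \in bK) (bwords p.2)) casimir].
Proof. by split; vm_compute. Qed.

Lemma K_inv : all (fun Y => has (fun Y' => bmul Y Y' == bone) bK) bK.
Proof. by vm_compute. Qed.

Lemma K_cosets : all (fun Y => all (fun Y' => (bmul Y Y' == bone) ==>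
    all (fun X => bisuni (bmul X Y') ==> (X == Y)) bK) bK) bK.
Proof. by vm_compute. Qed.

Lemma gen_check b : all (fun X => X \in bK) (bgen b).
Proof. by case: b; vm_compute. Qed.

(** Together with the Bruhat decomposition this gives G = U K. *)
Lemma UK_check :
  all (fun P => all (fun V => has (fun V' => has (fun Y =>
    bmul P V == bmul V' Y) bK) bunis) bunis) bperms.
Proof. by vm_compute. Qed.

Definition bcell A B := has (fun V => A == bmul V B) bunis.
(** Right multiplication by U permutes the two cosets U tau and U tau^2, whose
    union is a double coset, and similarly for sigma. *)
Lemma stable_check b :
  all (fun V =>
     let t := nth bone (bgen b) 0 in let t2 := nth bone (bgen b) 1 in
     (bcell (bmul t V) t && bcell (bmul t2 V) t2) ||
     (bcell (bmul t V) t2 && bcell (bmul t2 V) t)) bunis.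
Proof. by case: b; vm_compute. Qed.

Definition reduced_words : seq (seq bool) :=
  let s := false in let t := true in
  [:: [::]; [:: s]; [:: t]; [:: s; t]; [:: t; s]; [:: s; t; s]].

(** The function obtained by applying T_w to the indicator function of U is the
    indicator function of one double coset of U, and each occurs once. *)
Lemma cell_check :
  all (fun i => all (fun j =>
    odd (count (fun X => bisuni (bmul X (nth bone bperms j))) (bword (nth [::] reduced_words i)))
      == (i == j)) (iota 0 6)) (iota 0 6).
Proof. by vm_compute. Qed.

End BoolMatrices.

Opaque bK.

Lemma bK_mul X Y : X \in bK -> Y \in bK -> bmul X Y \in bK.
Proof. by have [h _ _ _ _] := K_check => XK YK; apply: (allP (allP h _ XK)). Qed.

Lemma bword_bK w X : X \in bword w -> X \in bK.
Proof.
elim: w X => [|b w IH] X.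
  by rewrite inE => /eqP ->; have [_ _ _ h _] := K_check.
case/allpairsP => -[Y Z] /= [Yb Zw ->].
by apply: bK_mul (IH _ Zw) (allP (gen_check b) _ Yb).
Qed.

Lemma bK_inv X : X \in bK -> binvertible X.
Proof. exact: (allP invertible_bK). Qed.

Lemma bunis_inv X : X \in bunis -> binvertible X.
Proof. exact: (allP invertible_bunis). Qed.

Lemma bperms_inv X : X \in bperms -> binvertible X.
Proof. exact: (allP invertible_bperms). Qed.

Lemma natr_addb (R : pzRingType) (b c : bool) : 1 + 1 = 0 :> R ->
  (b (+) c)%:R = b%:R + c%:R :> R.
Proof. by case: b; case: c => //= e; rewrite ?addr0 ?add0r // -e. Qed.

(** * Projectivity when q = 2 *)

(** The argument uses only that a group is modelled on boolean matrices, with the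
    unipotent ones as U and the six permutation matrices as representatives of the
    double cosets of U. *)

Section FlatModel.

Variables (F : fieldType) (gT : finGroupType) (U : {group gT}) (toG : bmx -> gT).
Local Notation V := {ffun gT -> F^o}.
Local Notation C := (ind1_mod F U).
Local Notation H := (hecke F U).
Hypothesis F2 : (1 + 1 : F) = 0.
Hypothesis toG_one : toG bone = 1%g.
Hypothesis toG_mul : forall X Y, binvertible X -> binvertible Y ->
  toG (bmul X Y) = (toG X * toG Y)%g.
Hypothesis unitri_bunis : forall g, g \in U -> exists2 X, X \in bunis & g = toG X.
Hypothesis toG_uni : forall X, X \in bunis -> toG X \in U.
Hypothesis toG_uniM : forall X Y, binvertible X -> binvertible Y ->
  (toG X * toG Y)%g \in U -> bmul X Y \in bunis.
Hypothesis cells : forall g, exists2 u, u \in U & exists2 u', u' \in U &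
  exists2 P, P \in bperms & (u * g * u')%g = toG P.

Implicit Types (X Y Z : bmx) (L : seq bmx) (w : seq bool).

Lemma sum_parity_eq L L' (phi : bmx -> F) : parity_eq L L' ->
  \sum_(X <- L) phi X = \sum_(X <- L') phi X.
Proof.
move=> /allP LL'.
have red (l : seq bmx) : {subset l <= L ++ L'} ->
    \sum_(X <- l) phi X = \sum_(X <- undup (L ++ L')) (odd (count_mem X l))%:R * phi X.
  elim: l => [|Y l IH] sl; first by rewrite big_nil big1 // => X _; rewrite mul0r.
  rewrite big_cons IH; last by move=> X Xl; apply: sl; rewrite inE Xl orbT.
  have Yu : Y \in undup (L ++ L') by rewrite mem_undup sl ?mem_head.
  have -> : phi Y = \sum_(X <- undup (L ++ L')) (Y == X)%:R * phi X.
    rewrite (bigD1_seq Y) ?undup_uniq //= eqxx mul1r big1 ?addr0 // => X XY.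
    by rewrite eq_sym (negbTE XY) mul0r.
  rewrite -big_split; apply: eq_bigr => X _ /=.
  by rewrite -mulrDl oddD oddb (natr_addb _ _ F2).
rewrite !red; first last.
- by move=> X Xl; rewrite mem_cat Xl.
- by move=> X Xl; rewrite mem_cat Xl orbT.
apply: eq_big_seq => X; rewrite mem_undup => /LL' /eqP -> //.
Qed.

Definition ops L : seq (F * gT) := [seq (1, toG X) | X <- L].

Lemma ltcomb_ops L (f : V) x : ltcomb (ops L) f x = \sum_(X <- L) (f (toG X * x)%g : F).
Proof. by rewrite ffunE big_map; apply: eq_bigr => X _; exact: mul1r. Qed.

Lemma cell_eq (f : V) A B x : f \in ind1 F U -> binvertible B -> bcell A B ->
  f (toG A * x)%g = f (toG B * x)%g.
Proof.
move=> /ind1P fU uB /hasP[W Wu /eqP ->].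
by rewrite (toG_mul (bunis_inv Wu) uB) -mulgA (fU (toG W)) ?toG_uni.
Qed.

Lemma ltcomb_gen b (f : V) x : ltcomb (ops (bgen b)) f x =
  (f (toG (nth bone (bgen b) 0) * x)%g : F) + f (toG (nth bone (bgen b) 1) * x)%g.
Proof.
rewrite ltcomb_ops.
have -> : bgen b = [:: nth bone (bgen b) 0; nth bone (bgen b) 1] by case: b.
by rewrite big_cons big_seq1.
Qed.

Lemma stable_gen b : stable U (ops (bgen b)).
Proof.
move=> f fC; apply/ind1P => u x /unitri_bunis[W Wu ->].
have := allP (stable_check b) W Wu => /=.
have gu i : (i < 2)%N -> binvertible (nth bone (bgen b) i).
  by case: b; case: i => [|[|]].
have fm i : (i < 2)%N -> f (toG (nth bone (bgen b) i) * (toG W * x))%g =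
    f (toG (bmul (nth bone (bgen b) i) W) * x)%g.
  by move=> i2; rewrite mulgA -(toG_mul (gu i i2) (bunis_inv Wu)).
move=> perm.
apply: (etrans (ltcomb_gen _ _ _)); apply: (etrans _ (esym (ltcomb_gen _ _ _))).
apply: (etrans (congr2 +%R (fm 0%N isT) (fm 1%N isT))).
case/orP: perm => /andP[c1 c2].
  by apply: congr2; apply: cell_eq => //; apply: gu.
apply: (etrans _ (addrC _ _)).
by apply: congr2; apply: cell_eq => //; apply: gu.
Qed.

Definition hgen b : H := hecke_ltcomb (@stable_gen b).

Definition hword w : H := foldr (fun b h => hgen b * h) 1 w.

Lemma ind1_fun_hword w (c : C) x :
  ind1_fun (hword w *: c) x = \sum_(X <- bword w) (ind1_fun c (toG X * x)%g : F).
Proof.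
elim: w x => [|b w IH] x.
  by rewrite scale1r big_seq1 toG_one mul1g.
rewrite [hword _]/= -scalerA hecke_ltcombE ltcomb_ops big_allpairs_dep.
apply: eq_big_seq => X Xb; rewrite IH; apply: eq_big_seq => Y Yw.
by rewrite (toG_mul (bK_inv (bword_bK Yw)) (bK_inv (allP (gen_check b) _ Xb))) mulgA.
Qed.

Definition hsum (ws : seq (seq bool)) : H := \sum_(w <- ws) hword w.

Lemma ind1_fun_hsum ws (c : C) x :
  ind1_fun (hsum ws *: c) x = \sum_(X <- bwords ws) (ind1_fun c (toG X * x)%g : F).
Proof.
rewrite /hsum scaler_suml ind1_fun_sum sum_ffunE big_flatten big_map.
by apply: eq_bigr => w _; rewrite ind1_fun_hword.
Qed.

Lemma hecke_ext (h h' : H) : (forall c x, ind1_fun (h *: c) x = ind1_fun (h' *: c) x) -> h = h'.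
Proof.
by move=> e; apply: hecke_eq; apply: ind1_fun_inj; apply/ffunP => x; apply: e.
Qed.

Lemma hsum_eq ws ws' : parity_eq (bwords ws) (bwords ws') -> hsum ws = hsum ws'.
Proof.
by move=> e; apply: hecke_ext => c x; rewrite !ind1_fun_hsum (sum_parity_eq _ e).
Qed.

Lemma hsum1 w : hsum [:: w] = hword w.
Proof. by rewrite /hsum big_seq1. Qed.

Lemma hsum_cat ws ws' : hsum (ws ++ ws') = hsum ws + hsum ws'.
Proof. by rewrite /hsum big_cat. Qed.

Lemma hsum_cons b ws : hgen b * hsum ws = hsum [seq b :: w | w <- ws].
Proof. by rewrite /hsum big_map mulr_sumr. Qed.

Lemma hword_eq w w' : parity_eq (bword w) (bword w') -> hword w = hword w'.
Proof.
by move=> e; rewrite -!hsum1; apply: hsum_eq; rewrite /bwords /= !cats0.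
Qed.

Lemma hword_rcons w b : hword w * hgen b = hword (rcons w b).
Proof.
elim: w => [|b' w IH] /=; first by rewrite mul1r mulr1.
by rewrite -IH mulrA.
Qed.

Lemma stable_scal (a : F) : stable U [:: (a, 1%g)].
Proof.
move=> f /ind1P fU; apply/ind1P => u x uU.
by rewrite !ffunE !big_seq1 !mul1g fU.
Qed.

Definition hscal a : H := hecke_ltcomb (@stable_scal a).

Lemma ind1_fun_hscal a (c : C) : ind1_fun (hscal a *: c) = a *: ind1_fun c.
Proof.
by rewrite hecke_ltcombE; apply/ffunP => x; rewrite !ffunE big_seq1 mul1g.
Qed.

Lemma hscalC a (h : H) : h * hscal a = hscal a * h.
Proof.
apply: hecke_ext => c x; rewrite -!scalerA ind1_fun_hscal.
by rewrite (hecke_scalar h (ind1_fun_hscal a c)).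
Qed.

Lemma hscalD a b : hscal (a + b) = hscal a + hscal b.
Proof.
apply: hecke_ext => c x.
by rewrite scalerDl raddfD /= !ind1_fun_hscal -scalerDl.
Qed.

Lemma hscalM a b : hscal (a * b) = hscal a * hscal b.
Proof.
by apply: hecke_ext => c x; rewrite -scalerA !ind1_fun_hscal scalerA.
Qed.

Lemma sum_odd (P : pred bmx) L :
  \sum_(X <- L) (P X)%:R = (odd (count P L))%:R :> F.
Proof.
elim: L => [|X L IH]; first by rewrite big_nil.
by rewrite big_cons IH /= oddD oddb (natr_addb _ _ F2).
Qed.

Lemma in_uni X P : X \in bK -> P \in bperms ->
  (toG X * toG P \in U)%g = bisuni (bmul X P).
Proof.
move=> XK Pp; have [uX uP] := (bK_inv XK, bperms_inv Pp).
apply/idP/idP => [|h]; first exact: toG_uniM.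
by rewrite -(toG_mul uX uP); exact: toG_uni.
Qed.

(** Both sides send the indicator function of U to bi-invariant functions, which
    are determined by their values at the permutation matrices. *)
Lemma hecke_span (h : H) : h = \sum_(i < 6)
  hscal (ind1_fun (h *: delta F U) (toG (nth bone bperms i))) * hword (nth [::] reduced_words i).
Proof.
apply: hecke_eq; apply: ind1_fun_inj; apply/ffunP => x.
have [u uU [u' u'U [P Pp eP]]] := cells x.
rewrite -(ind1_funUl _ x uU) -(hecke_delta_rinv h _ u'U).
rewrite -[RHS](ind1_funUl _ x uU) -[RHS](hecke_delta_rinv _ _ u'U) eP.
have [j j6 ->] : exists2 j : nat, (j < 6)%N & P = nth bone bperms j.
  by exists (index P bperms); [rewrite index_mem | rewrite nth_index].
have cell (i : 'I_6) :
    ind1_fun (hword (nth [::] reduced_words i) *: delta F U)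
      (toG (nth bone bperms j)) = (i == j :> nat)%:R.
  have hi : (i : nat) \in iota 0 6 by rewrite mem_iota ltn_ord.
  have hj : j \in iota 0 6 by rewrite mem_iota.
  have /eqP <- := allP (allP cell_check _ hi) _ hj.
  rewrite ind1_fun_hword -sum_odd.
  apply: eq_big_seq => X Xw; rewrite ind1_fun_delta (in_uni (bword_bK Xw)) //.
  by rewrite mem_nth.
rewrite scaler_suml ind1_fun_sum sum_ffunE (bigD1 (Ordinal j6)) //= big1 => [|i ij].
  by rewrite -scalerA ind1_fun_hscal ffunE (cell (Ordinal j6)) eqxx addr0; exact/esym/mulr1.
move: ij; rewrite -val_eqE /= => /negbTE ij.
by rewrite -scalerA ind1_fun_hscal ffunE cell ij; exact: mulr0.
Qed.

Section Lambda.

Variable eta : C -> F.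
Hypothesis etaD : forall c d, eta (c + d) = eta c + eta d.
Hypothesis etaZ : forall a c, eta (hscal a *: c) = a * eta c.

(** The H-linear map attached to the linear form eta by the dual bases. *)
Definition lambda (c : C) : H :=
  \sum_(p <- casimir) hscal (eta (hword p.1 *: c)) * hsum p.2.

Lemma lambdaD c d : lambda (c + d) = lambda c + lambda d.
Proof.
rewrite /lambda -big_split; apply: eq_bigr => p _ /=.
by rewrite scalerDr etaD hscalD mulrDl.
Qed.

Lemma lambda_scal a c : lambda (hscal a *: c) = hscal a * lambda c.
Proof.
rewrite /lambda mulr_sumr; apply: eq_bigr => p _.
by rewrite scalerA hscalC -scalerA etaZ hscalM mulrA.
Qed.

(** Multiplication by T_b on the right sends each T_w to some T_w', and
    multiplication by T_b on the left kills half of the dual basis and sends each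
    remaining element to the sum of two; the two operations are transposed to each
    other. *)
Lemma lambda_gen b c : lambda (hgen b *: c) = hgen b * lambda c.
Proof.
pose s := false; pose t := true.
pose a w := hscal (eta (hword w *: c)).
have aE w w' : parity_eq (bword (rcons w b)) (bword w') ->
    hscal (eta (hword w *: (hgen b *: c))) = a w'.
  by move=> e; rewrite scalerA hword_rcons (hword_eq e).
have g0 w ws : parity_eq (bwords [seq b :: v | v <- ws]) [::] ->
    hgen b * (a w * hsum ws) = 0.
  move=> e; rewrite mulrA hscalC -mulrA hsum_cons (@hsum_eq _ [::]) //.
  by rewrite /hsum big_nil mulr0.
have gD w ws ws1 ws2 : parity_eq (bwords [seq b :: v | v <- ws]) (bwords (ws1 ++ ws2)) ->
    hgen b * (a w * hsum ws) = a w * hsum ws1 + a w * hsum ws2.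
  move=> e; rewrite mulrA hscalC -mulrA hsum_cons (hsum_eq e) hsum_cat.
  exact: mulrDr.
rewrite /lambda mulr_sumr /casimir !big_cons !big_nil ![_.1]/= ![_.2]/= -!/(a _).
rewrite !addr0; case: b aE g0 gD => aE g0 gD.
  rewrite (aE [::] [:: t]); last by vm_compute.
  rewrite (aE [:: s] [:: s; t]); last by vm_compute.
  rewrite (aE [:: t] [:: t]); last by vm_compute.
  rewrite (aE [:: s; t] [:: s; t]); last by vm_compute.
  rewrite (aE [:: t; s] [:: s; t; s]); last by vm_compute.
  rewrite (aE [:: s; t; s] [:: s; t; s]); last by vm_compute.
  rewrite (g0 [::]); last by vm_compute.
  rewrite (g0 [:: s]); last by vm_compute.
  rewrite (g0 [:: t; s]); last by vm_compute.
  rewrite (gD [:: t] _ (nth ([::], [::]) casimir 0).2 (nth ([::], [::]) casimir 2).2);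
    last by vm_compute.
  rewrite (gD [:: s; t] _ (nth ([::], [::]) casimir 1).2 (nth ([::], [::]) casimir 3).2);
    last by vm_compute.
  rewrite (gD [:: s; t; s] _ (nth ([::], [::]) casimir 4).2 (nth ([::], [::]) casimir 5).2);
    last by vm_compute.
  by rewrite !add0r !addrA (ACl (1*3*2*4*5*6)).
rewrite (aE [::] [:: s]); last by vm_compute.
rewrite (aE [:: s] [:: s]); last by vm_compute.
rewrite (aE [:: t] [:: t; s]); last by vm_compute.
rewrite (aE [:: s; t] [:: s; t; s]); last by vm_compute.
rewrite (aE [:: t; s] [:: t; s]); last by vm_compute.
rewrite (aE [:: s; t; s] [:: s; t; s]); last by vm_compute.
rewrite (g0 [::]); last by vm_compute.
rewrite (g0 [:: t]); last by vm_compute.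
rewrite (g0 [:: s; t]); last by vm_compute.
rewrite (gD [:: s] _ (nth ([::], [::]) casimir 0).2 (nth ([::], [::]) casimir 1).2);
  last by vm_compute.
rewrite (gD [:: t; s] _ (nth ([::], [::]) casimir 2).2 (nth ([::], [::]) casimir 4).2);
  last by vm_compute.
rewrite (gD [:: s; t; s] _ (nth ([::], [::]) casimir 3).2 (nth ([::], [::]) casimir 5).2);
  last by vm_compute.
by rewrite !add0r !addrA (ACl (1*2*3*5*4*6)).
Qed.

Lemma lambda_linear h c : lambda (h *: c) = h * lambda c.
Proof.
have word w d : lambda (hword w *: d) = hword w * lambda d.
  elim: w => [|b w IH] /=; first by rewrite scale1r mul1r.
  by rewrite -scalerA lambda_gen IH mulrA.
rewrite {1}(hecke_span h) {2}(hecke_span h) scaler_suml mulr_suml.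
have l0 : lambda 0 = 0 by apply: (addrI (lambda 0)); rewrite -lambdaD !addr0.
rewrite (big_morph lambda lambdaD l0); apply: eq_bigr => i _.
by rewrite -scalerA lambda_scal word mulrA.
Qed.

End Lambda.

(** The matrix coefficients of Theta: point Y is the indicator function of the
    coset of Y in K, and eta Y is the value of Theta c at Y. *)
Definition eta Y (c : C) : F := \sum_(Z <- btheta) ind1_fun c (toG (bmul Z Y)).

Lemma etaD Y c d : eta Y (c + d) = eta Y c + eta Y d.
Proof.
by rewrite /eta -big_split; apply: eq_bigr => Z _; rewrite raddfD /= ffunE.
Qed.

Lemma eta_scal Y a c : eta Y (hscal a *: c) = a * eta Y c.
Proof.
by rewrite /eta mulr_sumr; apply: eq_bigr => Z _; rewrite ind1_fun_hscal ffunE.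
Qed.

Definition point Y : C := ind1_elt (rtrans_ind1 (toG Y)^-1%g (delta_fun_ind1 F U)).

Lemma ind1_fun_point Y x : ind1_fun (point Y) x = ((x * (toG Y)^-1)%g \in U)%:R.
Proof. by rewrite /ind1_fun /= !ffunE. Qed.

Lemma pointE X Y : X \in bK -> Y \in bK -> ind1_fun (point Y) (toG X) = (X == Y)%:R.
Proof.
move=> XK YK; rewrite ind1_fun_point; have [->|XY] := eqVneq X Y; first by rewrite mulgV group1.
suff -> : (toG X * (toG Y)^-1 \in U)%g = false by [].
have /hasP[Y' Y'K YY'] := allP K_inv _ YK.
have -> : ((toG Y)^-1 = toG Y')%g.
  apply: (mulgI (toG Y)); rewrite mulgV -(toG_mul (bK_inv YK) (bK_inv Y'K)).
  by rewrite (eqP YY') toG_one.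
apply: contraNF XY => /(toG_uniM (bK_inv XK) (bK_inv Y'K)) XY'.
have /implyP/(_ YY') h := allP (allP K_cosets _ YK) _ Y'K.
exact: (implyP (allP h _ XK)).
Qed.

Lemma UK_cosets (x : gT) : exists2 u, u \in U & exists2 Y, Y \in bK & x = (u * toG Y)%g.
Proof.
have [u uU [u' u'U [P Pp eP]]] := cells x.
have [W Wu eW] := unitri_bunis (groupVr u'U).
have /hasP[W' W'u /hasP[Y YK /eqP e]] := allP (allP UK_check _ Pp) _ Wu.
have ex : x = (u^-1 * (toG P * u'^-1))%g.
  by apply: (canRL (mulKg u)); apply: (canRL (mulgK u')); exact: eP.
have e2 : (toG P * u'^-1 = toG W' * toG Y)%g.
  rewrite eW -(toG_mul (bperms_inv Pp) (bunis_inv Wu)) e.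
  exact: (toG_mul (bunis_inv W'u) (bK_inv YK)).
exists (u^-1 * toG W')%g; first exact: (groupM (groupVr uU) (toG_uni W'u)).
exists Y; first exact: YK.
by rewrite ex e2 mulgA.
Qed.

(** Evaluated at Y in K, the left side is the operator
    sum_w Tbar_(w^-1 w0) Theta T_w applied to c, as all the translations involved
    stay inside K. *)
Lemma dual_basis (c : C) :
  \sum_(j < size bK) lambda (eta (nth bone bK j)) c *: point (nth bone bK j) = c.
Proof.
have [_ Kuniq thetaK _ wordsK] := K_check.
apply: ind1_fun_inj; apply/ffunP => x; have [u uU [Y YK ->]] := UK_cosets x.
rewrite !(ind1_funUl _ _ uU) {u uU x} ind1_fun_sum sum_ffunE.
pose E (X : bmx) : F := ind1_fun (lambda (eta X) c *: point X) (toG Y).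
have -> : \sum_(j < size bK)
    ind1_fun (lambda (eta (nth bone bK j)) c *: point (nth bone bK j)) (toG Y)
    = \sum_(X <- bK) E X.
  by rewrite [RHS](big_nth bone) big_mkord.
have EE X : X \in bK -> E X = \sum_(p <- casimir) \sum_(X' <- bwords p.2)
    eta X (hword p.1 *: c) * (bmul X' Y == X)%:R.
  move=> XK; rewrite /E /lambda scaler_suml ind1_fun_sum sum_ffunE.
  apply: eq_big_seq => p pc; rewrite -scalerA ind1_fun_hscal ffunE ind1_fun_hsum.
  rewrite [LHS]mulr_sumr; apply: eq_big_seq => X' X'p.
  have X'K := allP (allP wordsK _ pc) _ X'p.
  by rewrite -(toG_mul (bK_inv X'K) (bK_inv YK)) (pointE (bK_mul X'K YK) XK).
rewrite (eq_big_seq _ EE) exchange_big /=.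
have Ep p : p \in casimir -> \sum_(X <- bK) \sum_(X' <- bwords p.2)
    eta X (hword p.1 *: c) * (bmul X' Y == X)%:R =
    \sum_(r <- [seq (X', X) | X' <- bword p.1, X <- bwords p.2]) \sum_(Z <- btheta)
     (ind1_fun c (toG (bmul (bmul r.1 Z) r.2) * toG Y)%g : F).
  move=> pc; rewrite exchange_big [RHS]big_allpairs_dep [RHS]exchange_big.
  apply: eq_big_seq => X X'p; have XK := allP (allP wordsK _ pc) _ X'p.
  have XYK := bK_mul XK YK.
  rewrite (bigD1_seq (bmul X Y) XYK Kuniq) /= eqxx mulr1 big1 => [|X2 ne]; last first.
    by rewrite eq_sym (negbTE ne) mulr0.
  rewrite addr0 [RHS]exchange_big; apply: eq_big_seq => Z /(allP thetaK) ZK.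
  rewrite ind1_fun_hword; apply: eq_big_seq => X' X'w.
  have X'K := bword_bK X'w; have X'ZK := bK_mul X'K ZK.
  rewrite (toG_mul (bK_inv X'ZK) (bK_inv XK)) (toG_mul (bK_inv X'K) (bK_inv ZK)).
  rewrite (toG_mul (bK_inv ZK) (bK_inv XYK)) (toG_mul (bK_inv XK) (bK_inv YK)).
  by rewrite !mulgA.
rewrite (eq_big_seq _ Ep) -(big_map _ predT (fun l => \sum_(r <- l) _)) -big_flatten /=.
transitivity (\sum_(X <- [seq bmul (bmul r.1 Z) r.2 | r <- higman_pairs, Z <- btheta])
    (ind1_fun c (toG X * toG Y)%g : F)); first by rewrite [RHS]big_allpairs_dep.
by rewrite (sum_parity_eq _ higman_check) big_seq1 toG_one mul1g.
Qed.

Lemma flat_of_bool_model : flat (C : lmodType H).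
Proof.
apply: (dual_basis_flat (c := fun j : 'I_(size bK) => point (nth bone bK j))
  (lam := fun j => lambda (eta (nth bone bK j)))) => [j c d|j h c|c].
- by apply: lambdaD; apply: etaD.
- by apply: lambda_linear; [exact: etaD | exact: eta_scal].
- exact: dual_basis.
Qed.

End FlatModel.

(** * The boolean model of GL_3 *)

Section FlatGL.

Variable k : finFieldType.
Local Notation G := {'GL_3[k]}.
Local Notation U := (unitri_group k).
Hypothesis k2 : #|k| = 2%N.

Implicit Types (X Y Z : bmx).

Lemma k_bool (a : k) : a = (a != 0)%:R.
Proof.
have [->//|a0] := eqVneq a 0.
by have := expf_card_pred a0; rewrite k2.
Qed.

Lemma k_add11 : 1 + 1 = 0 :> k.
Proof. by rewrite -[RHS](natf_card k) k2. Qed.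

Lemma natr_andb (b c : bool) : (b && c)%:R = b%:R * c%:R :> k.
Proof. by rewrite -mulnb natrM. Qed.

Definition toM X : 'M[k]_3 :=
  let e i := (nth false X i)%:R in
  mx3 (e 0%N) (e 1%N) (e 2%N) (e 3%N) (e 4%N) (e 5%N) (e 6%N) (e 7%N) (e 8%N).

Lemma toM_mul X Y : toM (bmul X Y) = toM X *m toM Y.
Proof.
rewrite /toM mx3M /=.
by congr mx3; rewrite !(natr_addb _ _ k_add11) !natr_andb.
Qed.

Lemma toM_one : toM bone = 1%:M.
Proof. exact: mx3_1. Qed.

Lemma toM_unit X : binvertible X -> toM X \in unitmx.
Proof.
rewrite /binvertible; set Y := iter _ _ _ => /eqP e.
have e' : toM X *m toM Y = 1%:M by rewrite -toM_mul e toM_one.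
by case: (mulmx1_unit e').
Qed.

Definition toG X : G := gl3 (toM X).

Lemma toG_mul X Y : binvertible X -> binvertible Y ->
  toG (bmul X Y) = (toG X * toG Y)%g.
Proof. by move=> /toM_unit uX /toM_unit uY; rewrite /toG gl3M // toM_mul. Qed.

Lemma toG_one : toG bone = 1%g.
Proof. by apply: GLval_inj; rewrite /toG toM_one gl3E ?unitmx1. Qed.

Lemma unitri_bunis (g : G) : g \in U -> exists2 X, X \in bunis & g = toG X.
Proof.
move=> /unitriP[a [b [c ->]]]; exists (buni (a != 0) (b != 0) (c != 0)).
  by case: (a != 0); case: (b != 0); case: (c != 0).
by rewrite /uni /toG; congr gl3; rewrite /toM /unimx /= -!k_bool.
Qed.

Lemma toG_uni X : X \in bunis -> toG X \in U.
Proof.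
move=> /mapP[[[a b] c] _ ->]; apply/unitriP.
by exists a%:R, b%:R, c%:R.
Qed.

Lemma toM_inj X Y : size X = 9%N -> size Y = 9%N -> toM X = toM Y -> X = Y.
Proof.
have natb_inj (b c : bool) : b%:R = c%:R :> k -> b = c.
  by case: b; case: c => // /eqP; rewrite ?oner_eq0 // eq_sym oner_eq0.
move=> sX sY; case/mx3_inj => -[/natb_inj e0 /natb_inj e1 /natb_inj e2]
  [/natb_inj e3 /natb_inj e4 /natb_inj e5] [/natb_inj e6 /natb_inj e7 /natb_inj e8].
apply: (@eq_from_nth _ false) => [|i]; rewrite sX ?sY //.
by case: i => [|[|[|[|[|[|[|[|[|i]]]]]]]]].
Qed.

Lemma toG_uniM X Y : binvertible X -> binvertible Y ->
  (toG X * toG Y)%g \in U -> bmul X Y \in bunis.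
Proof.
move=> iX iY; rewrite -(toG_mul iX iY) => /unitri_bunis[W Wu e]; rewrite (_ : bmul X Y = W) //.
apply: toM_inj => //; first by case/mapP: Wu => p _ ->.
have := congr1 (@GLval 3 _) e; rewrite /toG (gl3E (toM_unit (bunis_inv Wu))) gl3E //.
by rewrite toM_mul unitmx_mul (toM_unit iX) (toM_unit iY).
Qed.

Lemma monomial_perm (g : G) : monomial (GLval g) ->
  exists2 P, P \in bperms & g = toG P.
Proof.
move=> mg; have dg := det_GL g.
have one (a : k) : a != 0 -> a = 1.
  by move=> a0; rewrite [a]k_bool a0.
suff [P Pp eP] : exists2 P, P \in bperms & GLval g = toM P.
  by exists P => //; apply: GLval_inj; rewrite /toG (gl3E (toM_unit (bperms_inv Pp))).
have [N mN eN] : exists2 N, monomial N & GLval g = N by exists (GLval g).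
rewrite eN in dg *; case: N / mN dg {eN} => p s r; rewrite det_mx3.
all: rewrite ?(mul0r, mulr0, subr0, sub0r, addr0, add0r, oppr0, mulrN, oppr_eq0).
all: rewrite !mulf_eq0 !negb_or => /and3P[/one -> /one -> /one ->].
- by exists (nth bone bperms 0).
- by exists (nth bone bperms 2).
- by exists (nth bone bperms 1).
- by exists (nth bone bperms 4).
- by exists (nth bone bperms 3).
- by exists (nth bone bperms 5).
Qed.

Lemma cells g : exists2 u, u \in U & exists2 u', u' \in U &
  exists2 P, P \in bperms & (u * g * u')%g = toG P.
Proof.
have [u uU [u' u'U /monomial_perm[P Pp eP]]] := bruhat g.
by exists u => //; exists u' => //; exists P.
Qed.

End FlatGL.

Lemma flat_of_card2 (k : finFieldType) (F : fieldType) :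
  #|k| = 2%N -> (1 + 1 : F) = 0 ->
  flat (ind1_mod F (unitri_group k) : lmodType (hecke F (unitri_group k))).
Proof.
move=> k2 F2; apply: (flat_of_bool_model F2 (toG_one k) (@toG_mul k k2) (@unitri_bunis k k2)
  (@toG_uni k) (@toG_uniM k k2) (@cells k k2)).
Qed.

Theorem proposition4p13 (p q : nat) (k : finFieldType)
    (hp : p \in [pchar k]) (hq : #|k| = q)
    (Fpbar : closedFieldType) (iota : {rmorphism k -> Fpbar})
    (hFpbar : forall x : Fpbar, algebraicOver iota x) :
  flat (ind1_mod Fpbar (unitri k) : lmodType (hecke Fpbar (unitri k)))
  <-> q = p /\ p = 2%N.
Proof.
have p_pr := pcharf_prime hp; have q_gt1 := card_gt1 k.
split=> [flatC|[qp p2]].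
  have q2 : #|k| = 2%N.
    apply/eqP; rewrite eqn_leq q_gt1 andbT leqNgt; apply/negP.
    by move=> /(@not_flat_of_card_gt2 _ _ iota).
  have : (p %| 2)%N by rewrite (dvdn_pcharf hp) -q2 natf_card.
  by rewrite dvdn_prime2 // => /eqP ->; rewrite -hq q2.
apply: flat_of_card2; first by rewrite hq qp p2.
by rewrite -(rmorph1 iota) -rmorphD -[1 + 1]/(2%:R) -p2 (pcharf0 hp) rmorph0.
Qed.
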